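(* Let $\mathcal{P}$ be $W(5,q)$ or $Q(6,q)$ and let $\mathcal{L}$ be a degree one Cameron-Liebler set of generators of $\mathcal{P}$ with parameter $x$, where $2\le x\le\sqrt[3]{2q^2}-\frac{\sqrt[3]{4q}}{3}+\frac16$. Then there is an integer $\alpha$ such that $\mathcal{L}$ is the union of the plane sets of $\alpha$ embedded hyperbolic quadrics $Q^+(5,q)$ (pairwise having no plane in common) and of $x-2\alpha$ point-pencils which are pairwise disjoint (i.e. whose vertices are pairwise non-collinear) and whose vertices are not contained in the $\alpha$ hyperbolic quadrics. For $\mathcal{P}=Q(6,q)$, or $\mathcal{P}=W(5,q)$ with $q$ even, $\alpha\in\{0,\dots,\lfloor x/2\rfloor\}$; for $\mathcal{P}=W(5,q)$ with $q$ odd, $\alpha=0$.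
   Context: $W(5,q)$ is the symplectic polar space and $Q(6,q)$ the parabolic quadric; both have rank $3$ and parameter $e=1$, and their generators are planes. With $A$ the real point-plane incidence matrix of $\mathcal{P}$, a set $\mathcal{L}$ of planes with characteristic vector $\chi$ is a degree one Cameron-Liebler set if $\chi\in\mathrm{im}(A^T)$; its parameter is $x=|\mathcal{L}|/((q+1)(q^2+1))$. A point-pencil with vertex $P$ is the set of all planes of $\mathcal{P}$ through the point $P$. An embedded hyperbolic quadric $Q^+(5,q)$ is a hyperbolic quadric of rank $3$ contained in $\mathcal{P}$ all of whose planes are planes of $\mathcal{P}$ (for $W(5,q)$ such quadrics exist only for $q$ even). *)

(* Defs.v *)
From HB Require Import structures.
From mathcomp Require Import all_boot all_order all_algebra.
From mathcomp Require Import reals exp.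

Set Implicit Arguments.
Unset Strict Implicit.
Unset Printing Implicit Defensive.

Import Order.TTheory GRing.Theory Num.Theory.
Local Open Scope ring_scope.

(* Projective subspaces of PG(n-1, q) are linear subspaces of F^n, F = GF(q):
   points, lines and planes have linear dimension 1, 2 and 3. *)
Section FiniteVspace.
Import VectorInternalTheory.

HB.instance Definition _ (F : finFieldType) (vT : vectType F) :=
  [Countable of {vspace vT} by <:].
HB.instance Definition _ (F : finFieldType) (vT : vectType F) :=
  [Finite of {vspace vT} by <:].

End FiniteVspace.

Definition bform (F : finFieldType) (n : nat) (M : 'M[F]_n) (u v : 'rV[F]_n) : F :=
  (u *m M *m v^T) 0 0.

(* Every quadratic form on F^n, in any characteristic, is qform M for some
   square (not necessarily symmetric) M. *)
Definition qform (F : finFieldType) (n : nat) (M : 'M[F]_n) (v : 'rV[F]_n) : F :=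
  bform M v v.

Definition polarization (F : finFieldType) (n : nat) (M : 'M[F]_n)
    (u v : 'rV[F]_n) : F :=
  qform M (u + v) - qform M u - qform M v.

(* No nonzero singular vector in the radical of the polarization: this is the
   right notion also in characteristic 2, where a form in odd dimension has a
   polarization with nonzero radical. *)
Definition nondegenerate_on (F : finFieldType) (n : nat) (M : 'M[F]_n)
    (W : {vspace 'rV[F]_n}) : Prop :=
  forall v, v \in W -> (forall w, w \in W -> polarization M v w = 0) ->
    qform M v = 0 -> v = 0.

Definition totally_singular (F : finFieldType) (n : nat) (M : 'M[F]_n)
    (U : {vspace 'rV[F]_n}) : bool :=
  [forall v in U, qform M v == 0].

Definition totally_isotropic (F : finFieldType) (n : nat) (J : 'M[F]_n)
    (U : {vspace 'rV[F]_n}) : bool :=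
  [forall u in U, forall v in U, bform J u v == 0].

(* A polar space embedded in PG(n-1, q) is given by the set of its subspaces
   (the zero subspace, i.e. the empty projective subspace, included). *)
Definition is_W5 (F : finFieldType) (n : nat) (S : {set {vspace 'rV[F]_n}}) : Prop :=
  n = 6%N /\
  exists J : 'M[F]_n,
    [/\ forall v, bform J v v = 0, J \in unitmx
      & S = [set U | totally_isotropic J U]].

Definition is_Q6 (F : finFieldType) (n : nat) (S : {set {vspace 'rV[F]_n}}) : Prop :=
  n = 7%N /\
  exists M : 'M[F]_n,
    nondegenerate_on M fullv /\ S = [set U | totally_singular M U].

Definition points (F : finFieldType) (n : nat) (S : {set {vspace 'rV[F]_n}}) :
    {set {vspace 'rV[F]_n}} :=
  [set U in S | \dim U == 1%N].

Definition planes (F : finFieldType) (n : nat) (S : {set {vspace 'rV[F]_n}}) :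
    {set {vspace 'rV[F]_n}} :=
  [set U in S | \dim U == 3%N].

(* For distinct points: the line joining them belongs to the polar space. *)
Definition collinear (F : finFieldType) (n : nat) (S : {set {vspace 'rV[F]_n}})
    (P P' : {vspace 'rV[F]_n}) : bool :=
  (P + P')%VS \in S.

Definition point_pencil (F : finFieldType) (n : nat) (S : {set {vspace 'rV[F]_n}})
    (P : {vspace 'rV[F]_n}) : {set {vspace 'rV[F]_n}} :=
  [set U in planes S | (P <= U)%VS].

Definition incidence_mx (R : realType) (F : finFieldType) (n : nat)
    (S : {set {vspace 'rV[F]_n}}) : 'M[R]_(#|points S|, #|planes S|) :=
  \matrix_(i, j) (enum_val i <= enum_val j)%VS%:R.

Definition char_vec (R : realType) (F : finFieldType) (n : nat)
    (S L : {set {vspace 'rV[F]_n}}) : 'cV[R]_#|planes S| :=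
  \col_j (enum_val j \in L)%:R.

Definition degree_one_CL (R : realType) (F : finFieldType) (n : nat)
    (S L : {set {vspace 'rV[F]_n}}) : Prop :=
  L \subset planes S /\
  exists w : 'cV[R]_#|points S|, char_vec R S L = (incidence_mx R S)^T *m w.

Definition CL_parameter (R : realType) (F : finFieldType) (n : nat)
    (L : {set {vspace 'rV[F]_n}}) : R :=
  #|L|%:R / ((#|F|%:R + 1) * (#|F|%:R ^+ 2 + 1)).

(* H is the point set of a Q^+(5, q): in a subspace W of linear dimension 6,
   the zero set of a nondegenerate quadratic form of Witt index 3 (a quadratic
   form on W is the restriction of one on F^n). *)
Definition hyperbolic_quadric (F : finFieldType) (n : nat)
    (H : {set {vspace 'rV[F]_n}}) : Prop :=
  exists (W : {vspace 'rV[F]_n}) (M : 'M[F]_n),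
    [/\ \dim W = 6%N, nondegenerate_on M W,
        exists U : {vspace 'rV[F]_n},
          [/\ (U <= W)%VS, \dim U = 3%N & totally_singular M U]
      & H = [set P | [&& \dim P == 1%N, (P <= W)%VS & totally_singular M P]]].

Definition quadric_planes (F : finFieldType) (n : nat)
    (H : {set {vspace 'rV[F]_n}}) : {set {vspace 'rV[F]_n}} :=
  [set U | (\dim U == 3%N) &&
     [forall P : {vspace 'rV[F]_n}, (\dim P == 1%N) && (P <= U)%VS ==> (P \in H)]].

Definition embedded_hyperbolic_quadric (F : finFieldType) (n : nat)
    (S H : {set {vspace 'rV[F]_n}}) : Prop :=
  [/\ hyperbolic_quadric H, H \subset points S & quadric_planes H \subset planes S].

Definition cbrt (R : realType) (a : R) : R := a `^ (3^-1).

(* Main.v *)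
Require Import Defs.
From mathcomp Require Import all_boot all_order all_algebra finfield.
From mathcomp Require Import reals exp ring lra zify.

(** Write the characteristic function of L as [pi |-> sum of w P over P in pi] with
    a weight w on the points; then x is the total weight.  Let n(l) be the number of
    planes of L on a line l, and let y(P) be the number of planes of L through a
    point P divided by q + 1.  Both are sums of w, and double counting gives
      sum_{P in l < pi} n(l) = y(P) + 2q [pi in L],    sum_{P in l} y(P) = x + q n(l),
      sum_{l < pi} n(l) = x + 2(q^2 + q) [pi in L],
      sum_{P in pi} y(P) = (q + 1) x + 2 q^2 [pi in L].
    The bound on x implies 2x <= q + 2.  If all planes through some point belong to
    L, remove them: x drops by 1.  Otherwise y <= x everywhere, which forces y >= 2 on
    the points of the planes of L and n(l) = 0 or n(l) >= 2 on every line.  Most points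
    of a plane of L have y = 2, and the planes of L through such a point form a
    (q + 1) x (q + 1) grid.  In W(5,q), q odd, there is no such grid.  In the other
    cases the grids produce two disjoint planes pi, pi' such that L contains all the
    planes spanned by a point Q of pi' and the line of pi orthogonal to Q; these planes
    cover a hyperbolic quadric, all of whose planes are in L because a plane not in L
    has sum_{P in pi} y(P) = (q + 1) x < 2 (q^2 + q + 1).  Remove them: x drops by 2. *)

Set Implicit Arguments.
Unset Strict Implicit.
Unset Printing Implicit Defensive.

Import Order.TTheory GRing.Theory Num.Theory.
Local Open Scope ring_scope.

(** * Subspaces of F^n *)

(** The planes through a point are the lines of a generalized quadrangle, Q(4,q) or W(3,q). A grid
    is a Q^+(3,q) inside Q(4,q); W(3,q) is isomorphic to Q(4,q) for q even and has no such grid for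
    q odd, which is where the cases part. The quadric Q^+(5,q) is glued from such grids. Each
    counting identity is linear in w, so it has to be checked only for the weight of a single point
    Q, where it becomes a statement on the position of Q. The weight w may take negative values;
    inequalities come from n, which counts planes, and from y, which is a sum of values of n at any
    point on a plane outside L. This is why full pencils are removed before anything is estimated.
    On a plane of L the excesses y - 2 add up to (q + 1)(x - 2), less than q^2; this leaves good
    points off any given line, hence the freedom to choose pi'. The induction carries 2x <= q + 2,
    which survives each removal, whereas 2 <= x does not. *)

Section Subspaces.

Variables (F : finFieldType) (n : nat).
Local Notation V := 'rV[F]_n.
Local Notation q := #|F|.
Implicit Types (U W P Q l m pi : {vspace V}) (v : V).

Let card_field_gt1 : (1 < q)%N := card_finNzRing_gt1 F.

Lemma card_nonzero_vectors U :
  #|[set v in U | v != 0]| = (q ^ \dim U - 1)%N.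
Proof.
rewrite -(@card_vspace F V (Vector.class V) U).
rewrite (cardD1 0 (mem U)) mem0v addKn.
by apply: eq_card => v; rewrite !inE andbC.
Qed.

Lemma dim1_line P v : \dim P = 1%N -> v \in P -> v != 0 -> <[v]>%VS = P.
Proof.
move=> dP vP v0; apply/eqP; rewrite eqEdim -memvE vP.
by rewrite dim_vline v0 dP.
Qed.

Lemma vpick_neq0 P : (0 < \dim P)%N -> vpick P != 0.
Proof. by rewrite vpick0 -dimv_eq0 lt0n. Qed.

Lemma dim1_vpick P : \dim P = 1%N -> <[vpick P]>%VS = P.
Proof. by move=> dP; apply: dim1_line; rewrite ?memv_pick // vpick_neq0 ?dP. Qed.

Definition points_of U : {set {vspace V}} := [set P | (\dim P == 1%N) && (P <= U)%VS].

(** A point carries q - 1 nonzero vectors; the product form spares a division of naturals. *)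
Lemma card_points_of_exp U : (#|points_of U| * (q - 1) = q ^ \dim U - 1)%N.
Proof.
rewrite -card_nonzero_vectors -[RHS]sum1_card.
rewrite (partition_big (fun v => <[v]>%VS) (mem (points_of U))) /=; last first.
  by move=> v; rewrite !inE dim_vline => /andP[vU ->]; rewrite -memvE vU.
rewrite -sum_nat_const; apply: eq_bigr => P; rewrite inE => /andP[/eqP dP PU].
rewrite sum1_card; transitivity #|[set v in P | v != 0]|.
  by rewrite card_nonzero_vectors dP expn1.
apply: eq_card => v; rewrite inE -[in RHS]topredE /= inE.
apply/andP/andP => [[vP v0]|[/andP[vU v0] /eqP <-]]; last by rewrite memv_line.
by rewrite v0 (subvP PU) //= (dim1_line dP).
Qed.

Lemma card_points_of1 U : \dim U = 1%N -> #|points_of U| = 1%N.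
Proof.
have := card_points_of_exp U; have := card_field_gt1 => + + dU; rewrite dU; nia.
Qed.

Lemma card_points_of2 U : \dim U = 2%N -> #|points_of U| = (q + 1)%N.
Proof.
have := card_points_of_exp U; have := card_field_gt1 => + + dU; rewrite dU.
by move=> ? ?; apply/eqP; rewrite -(@eqn_pmul2r (q - 1)) ?subn_gt0 //; nia.
Qed.

Lemma card_points_of3 U : \dim U = 3%N -> #|points_of U| = (q ^ 2 + q + 1)%N.
Proof.
have := card_points_of_exp U; have := card_field_gt1 => + + dU; rewrite dU.
by move=> ? ?; apply/eqP; rewrite -(@eqn_pmul2r (q - 1)) ?subn_gt0 //; nia.
Qed.

Lemma dim1_cap P U : \dim P = 1%N -> ~~ (P <= U)%VS -> \dim (U :&: P) = 0%N.
Proof.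
move=> dP; apply: contraNeq; rewrite -lt0n => ltP.
suff /eqP <- : (U :&: P)%VS == P by exact: capvSl.
by rewrite eqEdim capvSr dP.
Qed.

Lemma dim_add1 P U : \dim P = 1%N -> ~~ (P <= U)%VS -> \dim (U + P) = (\dim U).+1.
Proof.
move=> dP PU; have := dimv_sum_cap U P; rewrite (dim1_cap dP PU) dP; lia.
Qed.

Lemma dim_add_points P Q : \dim P = 1%N -> \dim Q = 1%N -> P != Q ->
  \dim (P + Q) = 2%N.
Proof.
move=> dP dQ nPQ; rewrite dim_add1 ?dP //.
by apply: contraNN nPQ => QP; rewrite eq_sym eqEdim QP dP dQ.
Qed.

Lemma subv_dim_eq U W : (U <= W)%VS -> \dim U = \dim W -> U = W.
Proof. by move=> UW dUW; apply/eqP; rewrite eqEdim UW dUW /=. Qed.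

Lemma line_points l P Q : \dim l = 2%N -> \dim P = 1%N -> \dim Q = 1%N ->
  P != Q -> (P <= l)%VS -> (Q <= l)%VS -> (P + Q)%VS = l.
Proof.
move=> dl dP dQ nPQ Pl Ql; apply: subv_dim_eq; first by rewrite subv_add Pl.
by rewrite dim_add_points.
Qed.

Lemma exists_point U : (0 < \dim U)%N -> exists2 P, \dim P = 1%N & (P <= U)%VS.
Proof.
move=> U0; exists <[vpick U]>%VS; first by rewrite dim_vline vpick_neq0.
by rewrite -memvE memv_pick.
Qed.

Lemma exists_point_notin U W : ~~ (U <= W)%VS ->
  exists P, [/\ \dim P = 1%N, (P <= U)%VS & ~~ (P <= W)%VS].
Proof.
case/subvPn => v vU vW; exists <[v]>%VS; rewrite -!memvE vU vW; split=> //.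
by rewrite dim_vline; case: eqP vW => // ->; rewrite mem0v.
Qed.

Lemma exists_second_point U P : \dim P = 1%N -> (1 < \dim U)%N ->
  exists Q, [/\ \dim Q = 1%N, (Q <= U)%VS & Q != P].
Proof.
move=> dP dU; have: ~~ (U <= P)%VS by apply/negP => /dimvS; rewrite dP; lia.
case/exists_point_notin => Q [dQ QU QP]; exists Q; split=> //.
by apply: contraNneq QP => ->.
Qed.

Lemma cap_lines_plane pi l m : \dim pi = 3%N -> \dim l = 2%N -> \dim m = 2%N ->
  (l <= pi)%VS -> (m <= pi)%VS -> l != m -> \dim (l :&: m) = 1%N.
Proof.
move=> dp dl dm lp mp nlm; have := dimv_sum_cap l m; rewrite dl dm.
have : (\dim (l + m) <= 3)%N by rewrite -dp dimvS // subv_add lp.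
have := dimvS (capvSl l m); rewrite dl => le2.
have : \dim (l :&: m)%VS <> 2%N.
  move=> d2; move/eqP: nlm; apply; transitivity (l :&: m)%VS.
    by apply/esym/subv_dim_eq; rewrite ?capvSl ?d2.
  by apply: subv_dim_eq; rewrite ?capvSr ?d2.
lia.
Qed.

Definition lines_through P pi : {set {vspace V}} :=
  [set l | [&& \dim l == 2%N, (P <= l)%VS & (l <= pi)%VS]].

Lemma card_lines_through P pi : \dim P = 1%N -> \dim pi = 3%N -> (P <= pi)%VS ->
  #|lines_through P pi| = (q + 1)%N.
Proof.
move=> dP dp Pp.
have cP : (#|points_of pi :\ P|.+1 = #|points_of pi|)%N.
  by rewrite (cardsD1 P (points_of pi)) inE dP Pp.
move: cP; rewrite card_points_of3 // -sum1_card.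
(* The q^2 + q points of pi other than P are sorted by their join with P, q of them to each line. *)
rewrite (partition_big (fun Q => (P + Q)%VS) (mem (lines_through P pi))) /=; last first.
  move=> Q; rewrite !inE => /and3P[nQP /eqP dQ Qp].
  by rewrite dim_add_points // 1?eq_sym // addvSl subv_add Pp Qp.
under eq_bigr => l.
  rewrite inE => /and3P[/eqP dl Pl lp].
  rewrite sum1_card (_ : #|_| = q); last first.
    have := card_points_of2 dl; rewrite (cardsD1 P) inE dP Pl /= add1n addn1 => -[<-].
    apply: eq_card => Q; rewrite -[in LHS]topredE /= !inE.
    apply/andP/and3P => [[/and3P[nQP /eqP dQ Qp] /eqP <-]|[nQP /eqP dQ Ql]].
      by rewrite dQ addvSr.
    by rewrite nQP dQ (subv_trans Ql lp) (line_points dl dP dQ) ?eqxx // eq_sym.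
  over.
rewrite sum_nat_const => E; apply/eqP.
rewrite -(@eqn_pmul2r q) ?(ltnW card_field_gt1) //.
by apply/eqP/succn_inj; rewrite [LHS]E mulnDl mul1n addn1 mulnn.
Qed.

Lemma exists_line_through P pi k k' : \dim P = 1%N -> \dim pi = 3%N -> (P <= pi)%VS ->
  exists m, [/\ m \in lines_through P pi, m != k & m != k'].
Proof.
move=> dP dp Pp.
have /card_gt0P[m] : (0 < #|lines_through P pi :\ k :\ k'|)%N.
  have := card_lines_through dP dp Pp; rewrite (cardsD1 k) (cardsD1 k').
  have := card_field_gt1; move: #|_ :\ _| => c.
  by case: (k \in _); case: (k' \in _); lia.
by rewrite !inE => /and3P[nk' nk mP]; exists m; rewrite !inE.
Qed.

Lemma dim_plane_cap pi W : \dim pi = 3%N -> ~~ (pi <= W)%VS ->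
  (2 <= \dim (pi :&: W))%N -> \dim (pi :&: W) = 2%N.
Proof.
move=> dp npW ge2; have := dimvS (capvSl pi W); rewrite dp => le3.
suff : \dim (pi :&: W)%VS <> 3%N by lia.
move=> d3; move/negP: npW; apply; apply/capv_idPl/subv_dim_eq; rewrite ?capvSl //.
by rewrite d3.
Qed.

End Subspaces.

(** * Rank 3 polar spaces with q + 1 planes on each line *)

(** What the counting takes from a form, so that W(5,q) and Q(6,q) are treated at once. By
    [polar_codim] the perp of a point cuts every subspace in at least a hyperplane; [polar_line] is
    where e = 1 enters. *)
Record polar_space (F : finFieldType) (n : nat) (S : {set {vspace 'rV[F]_n}})
    (perp : {vspace 'rV[F]_n} -> {vspace 'rV[F]_n}) : Prop := PolarSpace {
  polar_sub : forall U W, U \in S -> (W <= U)%VS -> W \in S;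
  polar_perp : forall U Q, U \in S -> \dim Q = 1%N -> (Q <= U)%VS -> (U <= perp Q)%VS;
  polar_join : forall U Q, U \in S -> Q \in points S -> (U <= perp Q)%VS -> (U + Q)%VS \in S;
  polar_sym : forall P Q, \dim P = 1%N -> \dim Q = 1%N -> (P <= perp Q)%VS -> (Q <= perp P)%VS;
  polar_codim : forall U Q, \dim Q = 1%N -> (\dim U <= (\dim (U :&: perp Q)).+1)%N;
  polar_rank : forall U, U \in S -> (\dim U <= 3)%N;
  polar_line : forall l, l \in S -> \dim l = 2%N ->
    #|[set pi in planes S | (l <= pi)%VS]| = (#|F| + 1)%N
}.

Section PolarGeometry.

Variables (F : finFieldType) (n : nat) (S : {set {vspace 'rV[F]_n}}).
Variable perp : {vspace 'rV[F]_n} -> {vspace 'rV[F]_n}.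
Hypothesis hS : polar_space S perp.
Local Notation q := #|F|.
Implicit Types (U W P Q l m pi : {vspace 'rV[F]_n}).

Lemma pointsP P : reflect (P \in S /\ \dim P = 1%N) (P \in points S).
Proof. by rewrite inE; apply: (iffP andP) => -[-> /eqP]. Qed.

Lemma planesP pi : reflect (pi \in S /\ \dim pi = 3%N) (pi \in planes S).
Proof. by rewrite inE; apply: (iffP andP) => -[-> /eqP]. Qed.

Lemma points_ofP U P : reflect (\dim P = 1%N /\ (P <= U)%VS) (P \in points_of U).
Proof. by rewrite inE; apply: (iffP andP) => -[/eqP]. Qed.

Lemma lines_throughP P pi l :
  reflect [/\ \dim l = 2%N, (P <= l)%VS & (l <= pi)%VS] (l \in lines_through P pi).
Proof. by rewrite inE; apply: (iffP and3P) => -[/eqP]. Qed.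

Lemma point_sub U P : U \in S -> \dim P = 1%N -> (P <= U)%VS -> P \in points S.
Proof. by move=> US dP PU; apply/pointsP; split=> //; apply: (polar_sub hS) US PU. Qed.

Lemma plane_sub pi U : pi \in planes S -> (U <= pi)%VS -> U \in S.
Proof. by move=> /planesP[pS _]; apply: (polar_sub hS pS). Qed.

Lemma plane_dim pi : pi \in planes S -> \dim pi = 3%N.
Proof. by case/planesP. Qed.

Lemma plane_max pi Q : pi \in planes S -> Q \in points S -> (pi <= perp Q)%VS -> (Q <= pi)%VS.
Proof.
move=> /planesP[pS dp] Qp; case/pointsP: (Qp) => _ dQ pQ; apply: contraT => nQ.
by have := polar_rank hS (polar_join hS pS Qp pQ); rewrite dim_add1 ?dp.
Qed.

Lemma dim_plane_cap_perp pi Q : pi \in planes S -> Q \in points S -> ~~ (Q <= pi)%VS ->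
  \dim (pi :&: perp Q) = 2%N.
Proof.
move=> pp Qp nQ; have [_ dQ] := pointsP _ Qp.
have := polar_codim hS pi dQ; have dp := plane_dim pp.
rewrite dp ltnS; apply: dim_plane_cap => //; apply: contraNN nQ.
exact: plane_max.
Qed.

Lemma plane_perpl P Q : P \in points S -> Q \in points S ->
  (P <= perp Q)%VS -> (Q <= perp P)%VS.
Proof. by move=> /pointsP[_ dP] /pointsP[_ dQ]; apply: (polar_sym hS). Qed.

Lemma plane_join l Q : l \in S -> \dim l = 2%N -> Q \in points S -> ~~ (Q <= l)%VS ->
  (l <= perp Q)%VS -> (l + Q)%VS \in planes S.
Proof.
move=> lS dl Qp nQ lQ; apply/planesP; split; first exact: (polar_join hS).
by case/pointsP: Qp => _ dQ; rewrite dim_add1 ?dl.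
Qed.

(** The number of planes through l and Q: q + 1 if Q is on l, only l + Q if Q is off l but
    orthogonal to it. *)
Definition line_weight l Q : nat := (q * (Q <= l)%VS + (l <= perp Q)%VS)%N.
(* [q + 1] times [point_weight P Q] is the number of planes through P and Q. *)
Definition point_weight P Q : nat := (q ^ 2 * (Q == P) + (P <= perp Q)%VS)%N.

Lemma card_planes_line_point l Q : l \in S -> \dim l = 2%N -> Q \in points S ->
  #|[set pi in planes S | (l <= pi)%VS && (Q <= pi)%VS]| = line_weight l Q.
Proof.
move=> lS dl Qp; rewrite /line_weight; case: (pointsP Q Qp) => QS dQ.
have [Ql|nQl] := boolP (Q <= l)%VS.
  rewrite (polar_perp hS lS dQ Ql) muln1 -(polar_line hS lS dl).
  apply: eq_card => pi; rewrite !inE; case: (boolP (l <= pi)%VS) => // lp.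
  by rewrite (subv_trans Ql lp).
rewrite muln0 add0n; have [lQ|nlQ] := boolP (l <= perp Q)%VS.
  transitivity #|[set (l + Q)%VS]|; last by rewrite cards1.
  apply: eq_card => pi; rewrite !inE.
  apply/andP/eqP => [[/andP[pS /eqP dp] lQp]|->].
    by apply/esym/subv_dim_eq; rewrite ?subv_add // dp dim_add1 ?dl.
  by rewrite addvSl addvSr (polar_join hS) // dim_add1 ?dl.
apply: eq_card0 => pi; rewrite !inE; apply: contraNF nlQ => /and3P[/andP[pS _] lp Qp'].
exact: subv_trans lp (polar_perp hS pS dQ Qp').
Qed.

(** Three positions of Q. For Q = P each of the q + 1 lines counts q + 1. For another Q in pi the
    line PQ counts q + 1 and the other q lines count 1. For Q outside pi only the line
    [pi :&: perp Q] can count, and it passes through P exactly when P and Q are orthogonal. *)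
Lemma sum_line_weight_plane P pi Q : pi \in planes S -> \dim P = 1%N -> (P <= pi)%VS ->
  Q \in points S ->
  (\sum_(l in lines_through P pi) line_weight l Q =
   point_weight P Q + 2 * q * (Q <= pi)%VS)%N.
Proof.
move=> pp dP Pp Qp; have [pS dp] := planesP _ pp; have [QS dQ] := pointsP _ Qp.
have clines := card_lines_through dP dp Pp.
rewrite /line_weight big_split /= -big_distrr /= /point_weight.
have [QP|nQP] := eqVneq Q P.
  rewrite QP Pp.
  rewrite (eq_bigr (fun=> 1%N)); last by move=> l /lines_throughP[_ -> _].
  rewrite [X in (_ + X)%N](eq_bigr (fun=> 1%N)); last first.
    move=> l /lines_throughP[_ Pl lp].
    by rewrite (polar_perp hS (plane_sub pp lp) dP Pl).
  rewrite !sum1_card clines (polar_perp hS (plane_sub pp Pp) dP (subvv _)) /=.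
  by rewrite !muln1; lia.
have [Qpi|nQpi] := boolP (Q <= pi)%VS.
  rewrite [X in (_ + X)%N](eq_bigr (fun=> 1%N)); last first.
    by move=> l /lines_throughP[_ Pl lp]; rewrite (subv_trans lp) ?(polar_perp hS pS).
  rewrite sum1_card clines (subv_trans Pp (polar_perp hS pS dQ Qpi)).
  have PQ : (P + Q)%VS \in lines_through P pi.
    by apply/lines_throughP; rewrite dim_add_points ?addvSl ?subv_add ?Pp // eq_sym.
  rewrite (bigD1 (P + Q)%VS) //= addvSr big1 => [|l /andP[/lines_throughP[dl Pl lp] nl]].
    by lia.
  apply/eqP; rewrite eqb0; apply: contraNN nl => Ql.
  by rewrite (line_points dl dP dQ) // eq_sym.
rewrite big1 => [|l /lines_throughP[dl Pl lp]]; last first.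
  by apply/eqP; rewrite eqb0; apply: contraNN nQpi => Ql; apply: subv_trans lp.
rewrite !muln0 !addn0 !add0n.
have dm := dim_plane_cap_perp pp Qp nQpi.
have capE l : l \in lines_through P pi -> (l <= perp Q)%VS = (l == pi :&: perp Q)%VS.
  case/lines_throughP => dl Pl lp; apply/idP/eqP => [lQ|->]; last exact: capvSr.
  by apply: subv_dim_eq; rewrite ?subv_cap ?lp // dl.
have [PQ|nPQ] := boolP (P <= perp Q)%VS.
  have mL : (pi :&: perp Q)%VS \in lines_through P pi.
    by apply/lines_throughP; rewrite dm subv_cap Pp PQ capvSl.
  rewrite (bigD1 (pi :&: perp Q)%VS) //= capvSr big1 ?addn0 // => l /andP[lL nl].
  by rewrite capE // (negPf nl).
rewrite big1 // => l lL; rewrite capE //; case: eqP => // lE.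
case/lines_throughP: lL => _ Pl _; move: nPQ.
by rewrite (subv_trans Pl) // lE capvSr.
Qed.

Lemma card_points_of_perp U Q : #|points_of (U :&: perp Q)%VS| =
  (\sum_(P in points_of U) (P <= perp Q)%VS)%N.
Proof.
rewrite -sum1_card big_mkcond [RHS]big_mkcond /=; apply: eq_bigr => P _.
by rewrite !inE subv_cap; case: (\dim P == 1%N); case: (P <= U)%VS; case: (P <= perp Q)%VS.
Qed.

Lemma sum_eq_point U Q : \dim Q = 1%N ->
  (\sum_(P in points_of U) (Q == P) = (Q <= U)%VS :> nat)%N.
Proof.
move=> dQ; have [QU|nQU] := boolP (Q <= U)%VS.
  rewrite (bigD1 Q) ?inE ?dQ //= eqxx big1 // => P /andP[_ nP].
  by rewrite eq_sym (negPf nP).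
rewrite big1 // => P /points_ofP[_ PU]; apply/eqP; rewrite eqb0.
by apply: contraNN nQU => /eqP->.
Qed.

Lemma sum_point_weight_line l Q : l \in S -> \dim l = 2%N -> Q \in points S ->
  (\sum_(P in points_of l) point_weight P Q = 1 + q * line_weight l Q)%N.
Proof.
move=> lS dl Qp; have [QS dQ] := pointsP _ Qp.
rewrite /point_weight big_split /= -big_distrr /= sum_eq_point // -card_points_of_perp.
rewrite /line_weight; have [lQ|nlQ] := boolP (l <= perp Q)%VS.
  rewrite (capv_idPl lQ) card_points_of2 //=.
  by rewrite mulnDr mulnA mulnn muln1 addnA addnC addnA addnAC (addnC 1%N).
rewrite (_ : (Q <= l)%VS = false); last first.
  by apply: contraNF nlQ => /(polar_perp hS lS dQ).
rewrite card_points_of1 ?muln0 //.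
have := polar_codim hS l dQ; have := dimvS (capvSl l (perp Q)); rewrite dl => le2 ge1.
suff : \dim (l :&: perp Q)%VS <> 2%N by lia.
move=> d2; move/negP: nlQ; apply; apply/capv_idPl/subv_dim_eq; rewrite ?capvSl //.
by rewrite d2.
Qed.

Lemma sum_point_weight_plane pi Q : pi \in planes S -> Q \in points S ->
  (\sum_(P in points_of pi) point_weight P Q = q + 1 + 2 * q ^ 2 * (Q <= pi)%VS)%N.
Proof.
move=> pp Qp; have [QS dQ] := pointsP _ Qp; have [pS dp] := planesP _ pp.
rewrite /point_weight big_split /= -big_distrr /= sum_eq_point // -card_points_of_perp.
have [Qpi|nQpi] := boolP (Q <= pi)%VS.
  rewrite (capv_idPl (polar_perp hS pS dQ Qpi)) card_points_of3 //=; lia.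
by rewrite card_points_of2 ?dim_plane_cap_perp // !muln0 add0n addn0.
Qed.

(** * Counting identities for a weight function on the points *)

Section Weights.

Variables (R : realFieldType) (w : {vspace 'rV[F]_n} -> R).

Definition weight U : R := \sum_(Q in points S) w Q * (Q <= U)%VS%:R.
Definition total_weight : R := \sum_(Q in points S) w Q.
Definition line_value l : R := \sum_(Q in points S) w Q * (line_weight l Q)%:R.
Definition point_value P : R := \sum_(Q in points S) w Q * (point_weight P Q)%:R.

Lemma line_valueE l : l \in S -> \dim l = 2%N ->
  line_value l = \sum_(pi in planes S | (l <= pi)%VS) weight pi.
Proof.
move=> lS dl; rewrite exchange_big /=; apply: eq_bigr => Q Qp.
rewrite -mulr_sumr -natr_sum -card_planes_line_point //; congr (_ * _%:R).
rewrite -sum1_card big_mkcond [RHS]big_mkcond /=; apply: eq_bigr => pi _; rewrite !inE.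
by case: (pi \in S); case: (\dim pi == 3%N); case: (l <= pi)%VS; case: (Q <= pi)%VS.
Qed.

Lemma sum_line_value_through P pi : pi \in planes S -> \dim P = 1%N -> (P <= pi)%VS ->
  \sum_(l in lines_through P pi) line_value l = point_value P + 2 * q%:R * weight pi.
Proof.
move=> pp dP Pp; rewrite exchange_big /= mulr_sumr -big_split; apply: eq_bigr => Q Qp /=.
rewrite -mulr_sumr -natr_sum sum_line_weight_plane // natrD !natrM; ring.
Qed.

Lemma sum_point_value_line l : l \in S -> \dim l = 2%N ->
  \sum_(P in points_of l) point_value P = total_weight + q%:R * line_value l.
Proof.
move=> lS dl; rewrite exchange_big /= mulr_sumr -big_split; apply: eq_bigr => Q Qp /=.
rewrite -mulr_sumr -natr_sum sum_point_weight_line // natrD !natrM; ring.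
Qed.

Lemma sum_point_value_plane pi : pi \in planes S ->
  \sum_(P in points_of pi) point_value P =
  (q%:R + 1) * total_weight + 2 * q%:R ^+ 2 * weight pi.
Proof.
move=> pp; rewrite exchange_big /= !mulr_sumr -big_split; apply: eq_bigr => Q Qp /=.
rewrite -mulr_sumr -natr_sum sum_point_weight_plane // !natrD !natrM; ring.
Qed.

Lemma sum_line_value_plane pi : pi \in planes S ->
  \sum_(l : {vspace 'rV[F]_n} | (\dim l == 2%N) && (l <= pi)%VS) line_value l =
  total_weight + (2 * q%:R ^+ 2 + 2 * q%:R) * weight pi.
Proof.
move=> pp; have [pS dp] := planesP _ pp; set s := LHS.
have q0 : (0 : R) < q%:R by rewrite ltr0n (ltnW (card_finNzRing_gt1 F)).
(* Each line of pi is counted once for each of its q + 1 points, so s follows from the two previous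
   sums after division by q + 1. *)
have : \sum_(P in points_of pi) \sum_(l in lines_through P pi) line_value l =
  (q%:R + 1) * s.
  rewrite (exchange_big_dep [pred l | (\dim l == 2%N) && (l <= pi)%VS]) /=; last first.
    by move=> P l /points_ofP[dP Pp] /lines_throughP[-> _ ->].
  rewrite mulr_sumr; apply: eq_bigr => l /andP[/eqP dl lp].
  rewrite natr1 mulr_natl.
  rewrite (eq_bigl (mem (points_of l))) => [|P]; last first.
    by rewrite !inE dl lp !andbT /=; case: (_ == _) => //=; apply/andb_idl => /subv_trans; apply.
  by rewrite sumr_const card_points_of2 // addn1.
under eq_bigr => P /points_ofP[dP Pp] do rewrite sum_line_value_through //.
rewrite big_split /= sum_point_value_plane // sumr_const card_points_of3 //.
rewrite -[X in _ + X = _]mulr_natl.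
move=> E; apply: (@mulfI _ (q%:R + 1)); first by rewrite gt_eqF // ltr_pwDl.
by rewrite -E !natrD natrX; ring.
Qed.

(** Up to the size of the pencil, not yet known, this describes y(P) by the planes through P. Line
    values are summed over the flags (l, pi) on P in two ways: a line carries q + 1 planes, a plane
    has q + 1 lines through P, and (q + 1)^2 - 2q = q^2 + 1. *)
Lemma sum_weight_pencil P : \dim P = 1%N ->
  #|point_pencil S P|%:R * point_value P =
  (q%:R ^+ 2 + 1) * \sum_(pi in point_pencil S P) weight pi.
Proof.
move=> dP; set s := \sum_(pi in _) _.
pose lP := [pred l | [&& l \in S, \dim l == 2%N & (P <= l)%VS]].
have flags (f : {vspace 'rV[F]_n} -> {vspace 'rV[F]_n} -> R) :
    \sum_(pi in point_pencil S P) \sum_(l in lines_through P pi) f l pi =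
    \sum_(l | lP l) \sum_(pi in [set pi in planes S | (l <= pi)%VS]) f l pi.
  rewrite (exchange_big_dep lP) /=; last first.
    move=> pi l; rewrite inE => /andP[pp Pp] /lines_throughP[-> -> lp].
    by rewrite (plane_sub pp).
  apply: eq_bigr => l /and3P[lS /eqP dl Pl]; apply: eq_bigl => pi; rewrite !inE dl Pl /=.
  by case: (boolP (l <= pi)%VS) => lp; rewrite ?andbF // (subv_trans Pl lp) !andbT.
have lines_const (f : {vspace 'rV[F]_n} -> R) :
    \sum_(pi in point_pencil S P) \sum_(l in lines_through P pi) f pi =
    (q%:R + 1) * \sum_(pi in point_pencil S P) f pi.
  rewrite mulr_sumr; apply: eq_bigr => pi; rewrite inE => /andP[/plane_dim dp Pp].
  by rewrite sumr_const card_lines_through // -[LHS]mulr_natl natrD.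
have E1 : \sum_(pi in point_pencil S P) \sum_(l in lines_through P pi) line_value l =
    (q%:R + 1) ^+ 2 * s.
  rewrite flags expr2 -mulrA -lines_const flags mulr_sumr; apply: eq_bigr.
  move=> l /and3P[lS /eqP dl Pl]; rewrite sumr_const (polar_line hS lS dl).
  rewrite -[LHS]mulr_natl natrD line_valueE //; congr (_ * _).
  by apply: eq_bigl => pi; rewrite !inE.
have : (q%:R + 1) ^+ 2 * s = #|point_pencil S P|%:R * point_value P + 2 * q%:R * s.
  have -> : #|point_pencil S P|%:R * point_value P =
      \sum_(pi in point_pencil S P) point_value P by rewrite sumr_const mulr_natl.
  rewrite -E1 mulr_sumr -big_split; apply: eq_bigr => pi.
  by rewrite inE => /andP[pp Pp]; rewrite sum_line_value_through.
by move=> E; apply: (addIr (2 * q%:R * s)); rewrite -E; ring.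
Qed.

End Weights.

Lemma exists_plane_through P : P \in points S -> planes S != set0 ->
  exists2 pi, pi \in planes S & (P <= pi)%VS.
Proof.
move=> Pp /set0Pn[pi pp]; have [Ppi|nP] := boolP (P <= pi)%VS; first by exists pi.
exists ((pi :&: perp P) + P)%VS; last exact: addvSr.
apply: plane_join => //; first by rewrite (plane_sub pp) ?capvSl.
- exact: dim_plane_cap_perp.
- by apply: contraNN nP => /subv_trans; apply; exact: capvSl.
- exact: capvSr.
Qed.

Lemma card_planes_through P : P \in points S -> planes S != set0 ->
  #|point_pencil S P| = ((q + 1) * (q ^ 2 + 1))%N.
Proof.
move=> Pp S0; have [pi pp Ppi] := exists_plane_through Pp S0.
have [_ dP] := pointsP _ Pp; have dp := plane_dim pp.
have [|Q [dQ Qpi nQP]] := @exists_second_point _ _ pi P dP; first by rewrite dp.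
have Qp : Q \in points S by apply: point_sub dQ Qpi; case/planesP: pp.
(* For the weight of one point Q of pi other than P, the identity for pencils has y(P) = 1 on the
   left and the q + 1 planes on the line PQ on the right, which yields the size of the pencil. *)
pose w P : rat := (P == Q)%:R.
have sumw (f : {vspace 'rV[F]_n} -> rat) : \sum_(P in points S) w P * f P = f Q.
  rewrite (bigD1 Q) //= /w eqxx mul1r big1 ?addr0 // => P' /andP[_ /negPf->].
  by rewrite mul0r.
have PQ : (P <= perp Q)%VS.
  by apply: subv_trans Ppi (polar_perp hS _ dQ Qpi); case/planesP: pp.
have := sum_weight_pencil w dP; rewrite /point_value sumw /point_weight (negPf nQP) PQ.
under eq_bigr do rewrite /weight sumw.
have cPQ : (\sum_(pi in point_pencil S P) (Q <= pi)%VS = q + 1 :> nat)%N.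
  transitivity #|[set pi in planes S | (P + Q <= pi)%VS]|.
    rewrite -sum1_card big_mkcond [RHS]big_mkcond; apply: eq_bigr => pi' _.
    by rewrite !inE subv_add; case: (_ \in S);
       case: (_ == _); case: (P <= pi')%VS; case: (Q <= pi')%VS.
  rewrite (polar_line hS) ?dim_add_points 1?eq_sym //.
  by rewrite (plane_sub pp) // subv_add Ppi.
rewrite muln0 add0n mulr1 -natr_sum cPQ => /eqP.
by rewrite -natrX natr1 -natrM eqr_nat => /eqP ->; rewrite mulnC !addn1.
Qed.

(** For a point Q of the polar space outside the plane pi this is the only plane through Q that
    meets pi in a line, by the one-or-all axiom. *)
Definition foot_plane pi Q := (pi :&: perp Q + Q)%VS.

(** * Two disjoint planes *)

Section Disjoint.

Variables pi pi' : {vspace 'rV[F]_n}.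
Hypotheses (pp : pi \in planes S) (pp' : pi' \in planes S).
Hypothesis disj : (pi :&: pi' = 0)%VS.

Lemma disjoint_point U : (0 < \dim U)%N -> (U <= pi')%VS -> ~~ (U <= pi)%VS.
Proof.
move=> U0 Up'; apply/negP => Up; have : (U <= pi :&: pi')%VS by rewrite subv_cap Up.
by rewrite disj subv0 -dimv_eq0 => /eqP dU; rewrite dU in U0.
Qed.

Section Point.

Variable Q : {vspace 'rV[F]_n}.
Hypotheses (dQ : \dim Q = 1%N) (Qp' : (Q <= pi')%VS).

Lemma disjoint_notin : ~~ (Q <= pi)%VS.
Proof. by apply: disjoint_point; rewrite ?dQ. Qed.

Lemma disjoint_in_points : Q \in points S.
Proof. by have [pS _] := planesP _ pp'; apply: point_sub dQ Qp'. Qed.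

Lemma dim_foot : \dim (pi :&: perp Q) = 2%N.
Proof. exact: dim_plane_cap_perp pp disjoint_in_points disjoint_notin. Qed.

Lemma foot_plane_in : foot_plane pi Q \in planes S.
Proof.
apply: plane_join disjoint_in_points _ _; rewrite ?dim_foot ?capvSr //.
  exact: plane_sub pp (capvSl _ _).
by apply: contraNN disjoint_notin => /subv_trans; apply; apply: capvSl.
Qed.

(** The foot plane contains a line of pi, which is disjoint from pi', so it can share no more than a
    point with pi'. *)
Lemma foot_plane_cap : (foot_plane pi Q :&: pi')%VS = Q.
Proof.
apply/esym/subv_dim_eq; first by rewrite subv_cap addvSr.
have le1 : (\dim (foot_plane pi Q :&: pi') <= 1)%N.
  have := dimv_sum_cap (pi :&: perp Q) (foot_plane pi Q :&: pi').
  have -> : (pi :&: perp Q :&: (foot_plane pi Q :&: pi') = 0)%VS.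
    apply/eqP; rewrite -subv0 -disj subv_cap.
    by rewrite (subv_trans (capvSl _ _) (capvSl _ _)) (subv_trans (capvSr _ _) (capvSr _ _)).
  rewrite dimv0 addn0 dim_foot => E.
  have : (\dim (pi :&: perp Q + foot_plane pi Q :&: pi') <= 3)%N.
    by rewrite -(plane_dim foot_plane_in) dimvS // subv_add addvSl capvSl.
  by rewrite E; lia.
have ge1 : (\dim Q <= \dim (foot_plane pi Q :&: pi'))%N.
  by rewrite dimvS // subv_cap addvSr.
by apply/eqP; rewrite eqn_leq ge1 dQ.
Qed.

End Point.

(** A point Q' with the same foot is orthogonal to the whole foot plane of Q, hence lies in it, and
    that plane meets pi' in Q alone. *)
Lemma foot_inj Q Q' : \dim Q = 1%N -> \dim Q' = 1%N -> (Q <= pi')%VS -> (Q' <= pi')%VS ->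
  (pi :&: perp Q)%VS = (pi :&: perp Q')%VS -> Q = Q'.
Proof.
move=> dQ dQ' Qp Qp' E; have [pS' _] := planesP _ pp'.
have Q'T : (Q' <= foot_plane pi Q)%VS.
  apply: plane_max (foot_plane_in dQ Qp) (disjoint_in_points dQ' Qp') _.
  rewrite subv_add (subv_trans Qp (polar_perp hS pS' dQ' Qp')) andbT.
  by rewrite E capvSr.
apply/esym/subv_dim_eq; last by rewrite dQ.
by rewrite -(foot_plane_cap dQ Qp) subv_cap Q'T.
Qed.

End Disjoint.

Lemma weight_points_of (R : realFieldType) (w : {vspace 'rV[F]_n} -> R) U : U \in S ->
  weight w U = \sum_(P in points_of U) w P.
Proof.
move=> US; rewrite /weight big_mkcond [RHS]big_mkcond; apply: eq_bigr => P _.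
have [/points_ofP[dP PU]|nP] := boolP (P \in points_of U).
  by rewrite (point_sub US dP PU) PU mulr1.
case: ifP => // /pointsP[_ dP]; move: nP; rewrite inE dP /= => /negPf->.
by rewrite mulr0.
Qed.

(** In a Q^+(5,q) two disjoint planes belong to opposite classes. The foot planes of the points of
    pi' belong to the class of pi'; they partition the points of the quadric outside pi and cover pi
    as well. *)
Definition regulus_points pi pi' : {set {vspace 'rV[F]_n}} :=
  [set P | (\dim P == 1%N) &&
    [exists Q in points_of pi', (P <= foot_plane pi Q)%VS]].

Definition meets_planes_in_subspaces (H : {set {vspace 'rV[F]_n}}) : Prop :=
  forall U, U \in planes S -> exists K,
    [/\ (K <= U)%VS, (2 <= \dim K)%N &
        forall P, \dim P = 1%N -> (P <= U)%VS -> (P \in H) = (P <= K)%VS].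

(** * The weight function of a hyperbolic quadric *)

Section QuadricWeight.

Variables (R : realFieldType) (H : {set {vspace 'rV[F]_n}}).
Hypothesis cutH : meets_planes_in_subspaces H.

(* A plane not contained in H meets H in the q + 1 points of a line, and the constant
   weight 1 / (q^2 + q + 1) takes the value 1 on every plane. *)
Definition quadric_weight P : R :=
  ((P \in H)%:R - (q%:R + 1) / (q%:R ^+ 2 + q%:R + 1)) / q%:R ^+ 2.

Lemma quadric_planesP U : \dim U = 3%N ->
  reflect (forall P, \dim P = 1%N -> (P <= U)%VS -> P \in H) (U \in quadric_planes H).
Proof.
move=> dU; rewrite inE dU; apply: (iffP forallP) => [h P dP PU|h P].
  by have /implyP := h P; apply; rewrite dP PU.
by apply/implyP => /andP[/eqP]; apply: h.
Qed.

Lemma sub_points U W : (forall P, \dim P = 1%N -> (P <= U)%VS -> (P <= W)%VS) -> (U <= W)%VS.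
Proof.
by move=> h; apply: contraT => /exists_point_notin[P [dP PU]]; rewrite h.
Qed.

Lemma quadric_cut U : U \in planes S -> exists K,
  [/\ (K <= U)%VS, \dim K = (2 + (U \in quadric_planes H))%N &
      forall P, \dim P = 1%N -> (P <= U)%VS -> (P \in H) = (P <= K)%VS].
Proof.
move=> Up; have dU := plane_dim Up; have [K [KU dK KH]] := cutH Up.
exists K; split=> //; have [UH|nUH] := boolP (U \in quadric_planes H).
  suff -> : K = U by rewrite dU.
  apply/eqP; rewrite eqEsubv KU; apply: sub_points => P dP PU.
  by rewrite -KH //; apply: (quadric_planesP dU).
have -> : K = (U :&: K)%VS by rewrite (capv_idPr KU).
apply: (dim_plane_cap dU); last by rewrite (capv_idPr KU).
apply: contraNN nUH => UK; apply/quadric_planesP => // P dP PU.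
by rewrite KH // (subv_trans PU).
Qed.

Lemma weight_quadric U : U \in planes S ->
  weight quadric_weight U = (U \in quadric_planes H)%:R.
Proof.
move=> Up; have dU := plane_dim Up; have [US _] := planesP _ Up.
have [K [KU dK KH]] := quadric_cut Up.
have q0 : (q%:R : R) != 0 by rewrite pnatr_eq0 -lt0n (ltnW (card_finNzRing_gt1 F)).
have s0 : (q%:R ^+ 2 + q%:R + 1 : R) != 0.
  by rewrite gt_eqF // ltr_pwDr // addr_ge0 // exprn_ge0.
rewrite weight_points_of // /quadric_weight -mulr_suml sumrB sumr_const card_points_of3 //.
have -> : \sum_(P in points_of U) (P \in H)%:R = #|points_of K|%:R :> R.
  rewrite -natr_sum -sum1_card big_mkcond [in RHS]big_mkcond; congr _%:R.
  apply: eq_bigr => P _; rewrite !inE; case: (eqVneq (\dim P) 1%N) => //= dP.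
  have [PU|nPU] := boolP (P <= U)%VS; first by rewrite KH //; case: (_ <= _)%VS.
  by case: ifP => // PK; rewrite (subv_trans PK KU) in nPU.
have -> : #|points_of K|%:R = q%:R + 1 + (U \in quadric_planes H)%:R * q%:R ^+ 2 :> R.
  move: dK; case: (_ \in _) => /= dK; first by rewrite card_points_of3 // !natrD natrX; ring.
  by rewrite card_points_of2 // natrD; ring.
rewrite -[X in _ - X]mulr_natr !natrD natrX; field.
by rewrite q0 s0.
Qed.

End QuadricWeight.

End PolarGeometry.

Definition regulus_quadrics (F : finFieldType) (n : nat) (S : {set {vspace 'rV[F]_n}})
    (perp : {vspace 'rV[F]_n} -> {vspace 'rV[F]_n}) : Prop :=
  forall pi pi', pi \in planes S -> pi' \in planes S -> (pi :&: pi' = 0)%VS ->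
    embedded_hyperbolic_quadric S (regulus_points perp pi pi') /\
    meets_planes_in_subspaces S (regulus_points perp pi pi').

(** In the quadrangle of lines and planes through P, the planes pi, rho, sigma are three pairwise
    skew lines; a transversal through every point of the first one is the part of a grid that is
    excluded. *)
Definition no_grid (F : finFieldType) (n : nat) (S : {set {vspace 'rV[F]_n}}) : Prop :=
  forall P pi rho sigma, \dim P = 1%N ->
    pi \in planes S -> rho \in planes S -> sigma \in planes S ->
    (pi :&: rho)%VS = P -> (pi :&: sigma)%VS = P -> (rho :&: sigma)%VS = P ->
    ~ (forall l, l \in lines_through P pi -> exists tau,
        [/\ tau \in planes S, (l <= tau)%VS, \dim (tau :&: rho) = 2%N &
            \dim (tau :&: sigma) = 2%N]).

(** * Degree one Cameron-Liebler sets *)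

Section CameronLiebler.

Variables (F : finFieldType) (n : nat) (S : {set {vspace 'rV[F]_n}}).
Variable perp : {vspace 'rV[F]_n} -> {vspace 'rV[F]_n}.
Hypothesis hS : polar_space S perp.
Variables (R : realFieldType) (w : {vspace 'rV[F]_n} -> R).
Variable L : {set {vspace 'rV[F]_n}}.
Hypothesis Lplanes : L \subset planes S.
Hypothesis weightL : forall pi, pi \in planes S -> weight S w pi = (pi \in L)%:R.
Local Notation q := #|F|.
Local Notation x := (total_weight S w).
Local Notation y := (point_value S perp w).
Implicit Types (U W P Q l m pi : {vspace 'rV[F]_n}).

Definition planes_on l : nat := #|[set pi in L | (l <= pi)%VS]|.

Let q_gt1 : (1 < q)%N := card_finNzRing_gt1 F.
Let qR_gt1 : (1 : R) < q%:R.
Proof. by rewrite ltr1n. Qed.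

Lemma CL_planes pi : pi \in L -> pi \in planes S.
Proof. exact: subsetP. Qed.

Lemma CL_point pi P : pi \in L -> \dim P = 1%N -> (P <= pi)%VS -> P \in points S.
Proof. by move=> /CL_planes/planesP[pS _]; apply: point_sub hS _ _ pS. Qed.

Lemma line_value_CL l : l \in S -> \dim l = 2%N ->
  line_value S perp w l = (planes_on l)%:R.
Proof.
move=> lS dl; rewrite (line_valueE hS) // (eq_bigr (fun pi => (pi \in L)%:R)); last first.
  by move=> pi /andP[pp _]; rewrite weightL.
rewrite -natr_sum /planes_on -sum1_card big_mkcond [in RHS]big_mkcond; congr _%:R.
apply: eq_bigr => pi _; rewrite [in RHS]inE; have [pL|nL] := boolP (pi \in L).
  by rewrite (CL_planes pL).
by case: ifP.
Qed.

Lemma planes_on_gt0 l pi : pi \in L -> (l <= pi)%VS -> (0 < planes_on l)%N.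
Proof. by move=> pL lp; apply/card_gt0P; exists pi; rewrite inE pL. Qed.

Lemma sum_planes_on_through P pi : pi \in planes S -> \dim P = 1%N -> (P <= pi)%VS ->
  (\sum_(l in lines_through P pi) planes_on l)%N%:R = y P + 2 * q%:R * (pi \in L)%:R.
Proof.
move=> pp dP Pp; rewrite -weightL // -sum_line_value_through // natr_sum.
apply: eq_bigr => l /lines_throughP[dl _ lp]; rewrite line_value_CL //.
exact: (plane_sub hS pp).
Qed.

Lemma sum_planes_on_plane pi : pi \in planes S ->
  (\sum_(l : {vspace 'rV[F]_n} | (\dim l == 2%N) && (l <= pi)%VS) planes_on l)%N%:R =
  x + (2 * q%:R ^+ 2 + 2 * q%:R) * (pi \in L)%:R.
Proof.
move=> pp; rewrite -weightL // -(sum_line_value_plane hS) // natr_sum.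
apply: eq_bigr => l /andP[/eqP dl lp]; rewrite line_value_CL //.
exact: (plane_sub hS pp).
Qed.

Lemma CL_set0_total : planes S != set0 -> L = set0 -> x = 0.
Proof.
case/set0Pn => pi pp L0; have := sum_planes_on_plane pp.
rewrite big1 => [|l _]; first by rewrite L0 inE mulr0 addr0.
by rewrite /planes_on; apply: eq_card0 => pi'; rewrite L0 !inE.
Qed.

(** Every point lies on (q + 1)(q^2 + 1) planes; this makes the parameter of L the total weight. *)
Lemma CL_total_card : planes S != set0 ->
  #|L|%:R = (q%:R + 1) * (q%:R ^+ 2 + 1) * x :> R.
Proof.
move=> S0; rewrite mulr_sumr -sum1_card natr_sum.
transitivity (\sum_(pi in planes S) weight S w pi).
  rewrite big_mkcond [RHS]big_mkcond; apply: eq_bigr => pi _.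
  have [pL|nL] := boolP (pi \in L); first by rewrite (CL_planes pL) weightL ?(CL_planes pL) ?pL.
  by case: ifP => // pp; rewrite weightL // (negPf nL).
rewrite exchange_big /=; apply: eq_bigr => P Pp.
rewrite -mulr_sumr -natr_sum mulrC; congr (_ * _).
have <- : #|point_pencil S P|%:R = (q%:R + 1) * (q%:R ^+ 2 + 1) :> R.
  by rewrite (card_planes_through hS) // natrM !natrD natrX.
congr _%:R; rewrite -sum1_card big_mkcond [RHS]big_mkcond; apply: eq_bigr => pi _.
by rewrite [in RHS]inE; case: (_ \in _); case: (_ <= _)%VS.
Qed.

(** * Sets containing no full pencil *)

Section NoPencil.

Hypothesis no_pencil : forall P, P \in points S ->
  exists pi, [/\ pi \in planes S, (P <= pi)%VS & pi \notin L].
Hypothesis x_small : 2 * x <= q%:R + 2.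

Lemma value_out P pi : pi \in planes S -> \dim P = 1%N -> (P <= pi)%VS -> pi \notin L ->
  y P = (\sum_(l in lines_through P pi) planes_on l)%N%:R.
Proof.
by move=> pp dP Pp nL; rewrite sum_planes_on_through // (negPf nL) mulr0 addr0.
Qed.

Lemma value_nat P : P \in points S -> exists k : nat, y P = k%:R.
Proof.
move=> Pp; have [pi [pp Ppi nL]] := no_pencil Pp; case/pointsP: Pp => _ dP.
by rewrite (value_out pp) //; eexists.
Qed.

(** In a plane through P outside L, the n(l) of the lines through P sum to y(P) and those of all
    lines sum to x. *)
Lemma value_le_total P : P \in points S -> y P <= x.
Proof.
move=> Pp; have [pi [pp Ppi nL]] := no_pencil Pp; case/pointsP: Pp => _ dP.
have := sum_planes_on_plane pp; rewrite (negPf nL) mulr0 addr0 => <-.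
rewrite (value_out pp) // ler_nat big_mkcond [leqRHS]big_mkcond; apply: leq_sum => l _.
rewrite inE; case: (\dim l == 2%N) => //=; case: (l <= pi)%VS; case: (P <= l)%VS => //.
Qed.

Lemma sum_value_line l : l \in S -> \dim l = 2%N ->
  \sum_(P in points_of l) y P = x + q%:R * (planes_on l)%:R.
Proof. by move=> lS dl; rewrite (sum_point_value_line hS) // line_value_CL. Qed.

(** If all q + 1 planes on l were in L, the values y on l would sum to x + q(q + 1); being at most x
    each, they would force x >= q + 1. *)
Lemma exists_plane_out l : l \in S -> \dim l = 2%N ->
  exists pi, [/\ pi \in planes S, (l <= pi)%VS & pi \notin L].
Proof.
move=> lS dl.
have [/existsP[pi /and3P[? ? ?]]|/existsPn full] :=
  boolP [exists pi, [&& pi \in planes S, (l <= pi)%VS & pi \notin L]]; first by exists pi.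
have cl : planes_on l = (q + 1)%N.
  rewrite -(polar_line hS lS dl); apply: eq_card => pi; rewrite [LHS]inE [RHS]inE.
  have [lp|] := boolP (l <= pi)%VS; rewrite ?andbF // !andbT.
  apply/idP/idP => [/CL_planes //|pp]; have := full pi; rewrite pp lp /=.
  by rewrite negbK.
have := sum_value_line lS dl; rewrite cl => E.
have : \sum_(P in points_of l) y P <= (q + 1)%N%:R * x.
  rewrite -(card_points_of2 dl) mulr_natl -sumr_const; apply: ler_sum => P.
  by case/points_ofP => dP Pl; apply/value_le_total/(point_sub hS lS dP Pl).
rewrite E natrD; move: x_small qR_gt1; nra.
Qed.

(** Each of the q + 1 lines l of pi through P also lies on a plane outside L, where n(l) is a term
    of y(P). Hence n(l) <= y(P), and the sum y(P) + 2q of the n(l) is at most (q + 1) y(P). *)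
Lemma value_ge2 P pi : pi \in L -> \dim P = 1%N -> (P <= pi)%VS -> 2 <= y P.
Proof.
move=> pL dP Pp; have pp := CL_planes pL; have dp := plane_dim pp.
have [k yk] := value_nat (CL_point pL dP Pp).
have line_out l : l \in lines_through P pi -> (0 < planes_on l <= k)%N.
  case/lines_throughP => dl Pl lp; rewrite (planes_on_gt0 pL lp) /=.
  have lS := plane_sub hS pp lp.
  have [tau [tp lt nL]] := exists_plane_out lS dl.
  have := value_out tp dP (subv_trans Pl lt) nL; rewrite yk => /eqP.
  rewrite eqr_nat => /eqP ->; rewrite (bigD1 l) ?leq_addr //=.
  by apply/lines_throughP.
have := sum_planes_on_through pp dP Pp; rewrite yk pL mulr1 => E.
have le : (\sum_(l in lines_through P pi) planes_on l <= (q + 1) * k)%N.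
  rewrite -(card_lines_through dP dp Pp) -sum_nat_const; apply: leq_sum => l /line_out.
  by case/andP.
have : (k + 2 * q <= (q + 1) * k)%N by rewrite -(ler_nat R) natrD natrM -E ler_nat.
rewrite mulnDl mul1n addnC leq_add2r mulnC leq_pmul2l; last exact: ltnW.
by rewrite ler_nat.
Qed.

(** For n(l) = 1 the values y on l would sum to x + q; being at least 2 each, they would force x >=
    q + 2. *)
Lemma planes_on_ge2 l : l \in S -> \dim l = 2%N -> (0 < planes_on l)%N ->
  (2 <= planes_on l)%N.
Proof.
move=> lS dl /card_gt0P[pi]; rewrite inE => /andP[pL lp].
rewrite leqNgt; apply/negP => lt2; have := sum_value_line lS dl.
have : (q + 1)%N%:R * 2 <= \sum_(P in points_of l) y P.
  rewrite -(card_points_of2 dl) mulr_natl -sumr_const; apply: ler_sum => P.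
  by case/points_ofP => dP Pl; apply: value_ge2 pL dP (subv_trans Pl lp).
have : (planes_on l)%:R <= 1%:R :> R by rewrite ler_nat.
rewrite natrD; move: x_small qR_gt1; nra.
Qed.

(* A point P of a plane of L is called good if y P = 2; by the lemmas below the planes
   of L through it form a grid. *)
Lemma good_planes_on P l pi : y P = 2 -> \dim P = 1%N -> \dim l = 2%N -> pi \in L ->
  (P <= l)%VS -> (l <= pi)%VS -> planes_on l = 2%N.
Proof.
move=> gP dP dl pL Pl lp; have pp := CL_planes pL; have dp := plane_dim pp.
have Pp := subv_trans Pl lp.
have ge2 m : m \in lines_through P pi -> (2 <= planes_on m)%N.
  case/lines_throughP => dm _ mp.
  exact: (planes_on_ge2 (plane_sub hS pp mp) dm (planes_on_gt0 pL mp)).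
have := sum_planes_on_through pp dP Pp; rewrite gP pL mulr1 -natrM -natrD => /eqP.
have -> : (2 + 2 * q = \sum_(m in lines_through P pi) 2)%N.
  by rewrite sum_nat_const (card_lines_through dP dp Pp) mulnDl addnC mulnC.
rewrite eqr_nat eq_sym (leqif_sum (fun m mL => leqif_eq (ge2 m mL))) => /forallP/(_ l).
by rewrite inE dl Pl lp /= => /eqP <-.
Qed.

(** In a plane outside L the n of the lines through P sum to y(P) = 2, and a line with n > 0 already
    contributes 2. This is the device that forces planes into L. *)
Lemma good_two_lines P l m pi : y P = 2 -> \dim P = 1%N -> pi \in planes S ->
  l \in lines_through P pi -> m \in lines_through P pi -> l != m ->
  (0 < planes_on l)%N -> (0 < planes_on m)%N -> pi \in L.
Proof.
move=> gP dP pp lP mP nlm l0 m0; apply: contraT => nL.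
have /lines_throughP[dl Pl lp] := lP; have /lines_throughP[dm Pm mp] := mP.
have := value_out pp dP (subv_trans Pl lp) nL; rewrite gP => /eqP.
rewrite eqr_nat (bigD1 l) //= (bigD1 m) /=; last by rewrite mP eq_sym.
have := planes_on_ge2 (plane_sub hS pp lp) dl l0.
have := planes_on_ge2 (plane_sub hS pp mp) dm m0.
move=> m2 l2; rewrite ltn_eqF //.
by apply: (@leq_trans (2 + 2)%N) => //; apply: leq_add => //; apply: ltn_addr.
Qed.

(** The plane tau joins l to the line of rho orthogonal to l; both lines pass through the good point
    P and lie on planes of L. *)
Lemma good_transversal P l pi rho : y P = 2 -> \dim P = 1%N -> pi \in L -> rho \in L ->
  (pi :&: rho)%VS = P -> \dim l = 2%N -> (P <= l)%VS -> (l <= pi)%VS ->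
  exists tau, [/\ tau \in L, (l <= tau)%VS & \dim (tau :&: rho) = 2%N].
Proof.
move=> gP dP pL rL capP dl Pl lp.
have pp := CL_planes pL; have rp := CL_planes rL.
have [|Q [dQ Ql nQP]] := @exists_second_point _ _ l P dP; first by rewrite dl.
have [piS _] := planesP _ _ pp.
have Qpi := subv_trans Ql lp; have Qp := point_sub hS piS dQ Qpi.
have nQrho : ~~ (Q <= rho)%VS.
  apply: contraNN nQP => Qr; rewrite eqEdim dP dQ andbT.
  by rewrite -capP subv_cap Qpi.
have Prho : (P <= rho)%VS by rewrite -capP capvSr.
pose m := (rho :&: perp Q)%VS.
have dm : \dim m = 2%N by apply: dim_plane_cap_perp hS _ _ rp Qp nQrho.
have Pm : (P <= m)%VS.
  by rewrite subv_cap Prho (subv_trans _ (polar_perp hS piS dQ Qpi)) // (subv_trans Pl).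
have nQm : ~~ (Q <= m)%VS by apply: contraNN nQrho => /subv_trans; apply; apply: capvSl.
have mr : (m <= rho)%VS by apply: capvSl.
have tp : (m + Q)%VS \in planes S.
  by apply: (plane_join hS) => //; [exact: (plane_sub hS rp mr) | exact: capvSr].
have lt : (l <= m + Q)%VS.
  rewrite -(line_points dl dP dQ _ Pl Ql) 1?eq_sym //.
  by rewrite subv_add addvSr (subv_trans Pm) ?addvSl.
exists (m + Q)%VS; split=> //.
  apply: (@good_two_lines P l m) => //.
  - by apply/lines_throughP.
  - by apply/lines_throughP; rewrite addvSl.
  - by apply: contraNneq nQm => <-.
  - exact: planes_on_gt0 pL lp.
  - exact: planes_on_gt0 rL mr.
apply: dim_plane_cap (plane_dim tp) _ _; last by rewrite -dm dimvS // subv_cap addvSl.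
by apply: contraNN nQrho; apply: subv_trans (addvSr m Q).
Qed.

Lemma second_plane P l pi : y P = 2 -> \dim P = 1%N -> \dim l = 2%N -> pi \in L ->
  (P <= l)%VS -> (l <= pi)%VS -> exists tau, [/\ tau \in L, (l <= tau)%VS & tau != pi].
Proof.
move=> gP dP dl pL Pl lp.
have /card_gt0P[tau] : (0 < #|[set tau in L | (l <= tau)%VS] :\ pi|)%N.
  have := good_planes_on gP dP dl pL Pl lp.
  by rewrite /planes_on (cardsD1 pi) inE pL lp /= add1n => -[->].
by rewrite !inE => /and3P[? ? ?]; exists tau.
Qed.

Lemma planes_cap_line pi tau l : pi \in planes S -> tau \in planes S -> tau != pi ->
  \dim l = 2%N -> (l <= pi)%VS -> (l <= tau)%VS -> (pi :&: tau)%VS = l.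
Proof.
move=> /plane_dim dp /plane_dim dt ntp dl lp lt.
apply/esym/subv_dim_eq; first by rewrite subv_cap lp.
rewrite dl dim_plane_cap //; last by rewrite -dl dimvS // subv_cap lp.
by apply: contraNN ntp => ptau; rewrite eq_sym eqEdim ptau dp dt.
Qed.

(** A quadrangle has no triangles: a further common point of pi and rho would be orthogonal to k + m
    = tau, hence lie in tau, and so in both k and m. *)
Lemma planes_no_triangle pi rho tau k m P : pi \in planes S -> rho \in planes S ->
  tau \in planes S -> pi != tau -> rho != tau -> \dim P = 1%N ->
  k \in lines_through P tau -> m \in lines_through P tau -> k != m ->
  (k <= pi)%VS -> (m <= rho)%VS -> (pi :&: rho)%VS = P.
Proof.
move=> pp rp tp npt nrt dP /lines_throughP[dk Pk kt] /lines_throughP[dm Pm mt] nkm kp mr.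
have kE := planes_cap_line tp pp npt dk kt kp.
have mE := planes_cap_line tp rp nrt dm mt mr.
have kmE : (k :&: m)%VS = P.
  apply/esym/subv_dim_eq; first by rewrite subv_cap Pk.
  by rewrite dP (cap_lines_plane (plane_dim tp)).
apply/eqP; rewrite eqEsubv subv_cap (subv_trans Pk kp) (subv_trans Pm mr) !andbT.
apply: contraT => /exists_point_notin[Y [dY]]; rewrite subv_cap => /andP[Yp Yr] nYP.
have [piS _] := planesP _ _ pp; have [rS _] := planesP _ _ rp.
have Yt : (Y <= tau)%VS.
  apply: (plane_max hS tp); first exact: (point_sub hS piS dY Yp).
  have <- : (k + m)%VS = tau.
    apply: subv_dim_eq; first by rewrite subv_add kt.
    by have /eqP := dimv_sum_cap k m; rewrite kmE dP dk dm (plane_dim tp) (eqn_add2r 1 _ 3) => /eqP.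
  by rewrite subv_add (subv_trans kp) ?(subv_trans mr) // (polar_perp hS).
by move: nYP; rewrite -kmE subv_cap -kE -mE !subv_cap Yt Yp Yr.
Qed.

(** Three planes of one family of the grid, obtained from a plane tau of the other family: pi, rho
    and sigma meet tau in three different lines through P. *)
Lemma good_triple P pi : y P = 2 -> \dim P = 1%N -> pi \in L -> (P <= pi)%VS ->
  exists rho sigma, [/\ rho \in L, sigma \in L, (pi :&: rho)%VS = P,
    (pi :&: sigma)%VS = P & (rho :&: sigma)%VS = P].
Proof.
move=> gP dP pL Pp; have pp := CL_planes pL.
have [k [kP _ _]] := exists_line_through P P dP (plane_dim pp) Pp.
have [dk Pk kp] := lines_throughP _ _ _ kP.
have [tau [tL kt ntp]] := second_plane gP dP dk pL Pk kp.
have tp := CL_planes tL; have dt := plane_dim tp; have Pt := subv_trans Pk kt.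
have kT : k \in lines_through P tau by apply/lines_throughP.
have [m [mT nmk _]] := exists_line_through k k dP dt Pt.
have [m' [m'T nm'k nm'm]] := exists_line_through k m dP dt Pt.
have [dm Pm mt] := lines_throughP _ _ _ mT.
have [dm' Pm' mt'] := lines_throughP _ _ _ m'T.
have [rho [rL mr nrt]] := second_plane gP dP dm tL Pm mt.
have [sigma [sL ms nst]] := second_plane gP dP dm' tL Pm' mt'.
have rp := CL_planes rL; have sp := CL_planes sL.
exists rho, sigma; split=> //.
- by apply: (@planes_no_triangle pi rho tau k m); rewrite // eq_sym.
- by apply: (@planes_no_triangle pi sigma tau k m'); rewrite // eq_sym.
- by apply: (@planes_no_triangle rho sigma tau m m'); rewrite // eq_sym.
Qed.

Definition bad_points U : {set {vspace 'rV[F]_n}} := [set P in points_of U | y P != 2].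

(** The values on a plane of L are integers not below 2, so each bad point adds at least 1 to the
    excess of the sum over 2 per point. *)
Lemma card_bad_points U pi : pi \in L -> (U <= pi)%VS ->
  #|bad_points U|%:R <= \sum_(P in points_of U) y P - 2 * #|points_of U|%:R.
Proof.
move=> pL Up; have -> : 2 * #|points_of U|%:R = \sum_(P in points_of U) 2 :> R.
  by rewrite sumr_const mulr_natr.
rewrite -sumrB -sum1_card natr_sum.
rewrite big_mkcond [leRHS]big_mkcond; apply: ler_sum => P _; rewrite [P \in bad_points _]inE.
case: (boolP (P \in points_of U)) => [/points_ofP[dP PU]|] //=.
have := value_ge2 pL dP (subv_trans PU Up).
have [k ->] := value_nat (CL_point pL dP (subv_trans PU Up)).
rewrite (eqr_nat R k 2) (ler_nat R 2 k); have [->|nk] /= := eqVneq k 2; first by rewrite subrr.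
by rewrite lerBrDr -(natrD R 1 2) ler_nat (ltn_neqAle 2) eq_sym nk.
Qed.

Lemma card_bad_points_line l pi : pi \in L -> (l <= pi)%VS -> \dim l = 2%N ->
  planes_on l = 2%N -> #|bad_points l|%:R <= x - 2.
Proof.
move=> pL lp dl l2; apply: le_trans (card_bad_points pL lp) _.
rewrite sum_value_line ?(plane_sub hS (CL_planes pL)) // l2 card_points_of2 // natrD.
by lra.
Qed.

(** At most (q + 1)(x - 2) points of pi are bad, which is less than q^2, and at most q + 1 of its
    q^2 + q + 1 points are on l. *)
Lemma exists_good_notin l pi : pi \in L -> \dim l = 2%N ->
  exists P, [/\ \dim P = 1%N, (P <= pi)%VS, ~~ (P <= l)%VS & y P = 2].
Proof.
move=> pL dl; have pp := CL_planes pL; have dp := plane_dim pp.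
have bad := card_bad_points pL (subvv pi).
rewrite (sum_point_value_plane hS) // weightL // pL card_points_of3 // in bad.
have [cover|] := boolP (points_of pi \subset bad_points pi :|: points_of l); last first.
  case/subsetPn => P /points_ofP[dP Pp]; rewrite !inE dP Pp /=.
  by case/norP => /negbNE/eqP gP nPl; exists P.
have := leq_trans (subset_leq_card cover) (leq_card_setU _ _).
rewrite card_points_of3 // card_points_of2 // -(ler_nat R) !natrD natrX.
move: bad; rewrite mulr1 !natrD natrX; move: x_small qR_gt1; nra.
Qed.

Lemma good_join P pi rho z : y P = 2 -> \dim P = 1%N -> pi \in L -> rho \in L ->
  (pi :&: rho)%VS = P -> \dim z = 1%N -> (z <= pi)%VS -> z != P ->
  exists tau, [/\ tau \in L, (z <= tau)%VS, (P <= tau)%VS & \dim (tau :&: rho) = 2%N].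
Proof.
move=> gP dP pL rL capP dz zp nzP.
have Pp : (P <= pi)%VS by rewrite -capP capvSl.
have [|||tau [tL lt dt]] := @good_transversal P (P + z)%VS pi rho gP dP pL rL capP.
- by rewrite dim_add_points // eq_sym.
- exact: addvSl.
- by rewrite subv_add Pp.
by exists tau; split=> //; apply: subv_trans lt; [exact: addvSr | exact: addvSl].
Qed.

(** The foot plane contains two lines through the good point P that lie on planes of L: the foot of
    Q, in pi, and the line PQ, in rho. *)
Lemma foot_plane_in_CL pi pi' rho P Q : pi \in L -> pi' \in L -> rho \in L ->
  (pi :&: pi' = 0)%VS -> y P = 2 -> \dim P = 1%N -> (P <= pi)%VS -> (P <= rho)%VS ->
  \dim Q = 1%N -> (Q <= pi')%VS -> (Q <= rho)%VS -> foot_plane perp pi Q \in L.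
Proof.
move=> pL pL' rL disj gP dP Pp Pr dQ Qp' Qr.
have [pp pp' rp] := And3 (CL_planes pL) (CL_planes pL') (CL_planes rL).
have nQp := disjoint_notin disj dQ Qp'.
have Pf : (P <= pi :&: perp Q)%VS.
  have [rS _] := planesP _ _ rp.
  by rewrite subv_cap Pp (subv_trans Pr) // (polar_perp hS).
apply: (@good_two_lines P (pi :&: perp Q) (P + Q)) => //.
- exact: (foot_plane_in hS pp pp' disj dQ Qp').
- by apply/lines_throughP; rewrite (dim_foot hS pp pp') // addvSl.
- apply/lines_throughP; rewrite addvSl subv_add addvSr andbT (subv_trans Pf (addvSl _ _)).
  by rewrite dim_add_points //; apply: contraNneq nQp => <-.
- apply: contraNneq nQp => E; apply: subv_trans (addvSr P Q) _.
  by rewrite -E capvSl.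
- exact: planes_on_gt0 pL (capvSl _ _).
- by apply: planes_on_gt0 rL _; rewrite subv_add Pr.
Qed.

(* For every good point Y of rho :&: pi' the line joining Q to the point of the foot
   of Q orthogonal to Y lies on a plane of L; if the plane on Q were not in L, it would
   contain at most y Q / 2 such lines. *)
Lemma foot_planes_in_CL pi pi' rho P X : pi \in L -> pi' \in L -> rho \in L ->
  (pi :&: pi' = 0)%VS -> y P = 2 -> \dim P = 1%N -> (P <= pi)%VS -> (P <= rho)%VS ->
  \dim (rho :&: pi') = 2%N -> y X = 2 -> \dim X = 1%N -> (X <= rho :&: pi')%VS ->
  forall Q, \dim Q = 1%N -> (Q <= pi')%VS -> foot_plane perp pi Q \in L.
Proof.
move=> pL pL' rL disj gP dP Pp Pr dj gX dX Xj Q dQ Qp'.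
have [pp pp' rp] := And3 (CL_planes pL) (CL_planes pL') (CL_planes rL).
have [[piS dpi] [piS' dpi'] [rS dr]] := And3 (planesP _ _ pp) (planesP _ _ pp') (planesP _ _ rp).
set j := (rho :&: pi')%VS in dj Xj.
have [Qr|nQr] := boolP (Q <= rho)%VS; first exact: (foot_plane_in_CL pL pL' rL disj gP).
apply: contraT => nTL.
have jr : (j <= rho)%VS by apply: capvSl.
have jp' : (j <= pi')%VS by apply: capvSr.
have j2 := good_planes_on gX dX dj pL' Xj jp'.
have badj := card_bad_points_line pL' jp' dj j2.
have Qp := disjoint_in_points hS pp' dQ Qp'.
have nQpi := disjoint_notin disj dQ Qp'.
have Pp1 := CL_point pL dP Pp.
have nPpi' : ~~ (P <= pi')%VS.
  by apply: disjoint_notin Pp; rewrite // capvC.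
have jE : (pi' :&: perp P)%VS = j.
  apply/esym/subv_dim_eq; first by rewrite subv_cap jp' (subv_trans jr) ?(polar_perp hS).
  by rewrite dj (dim_plane_cap_perp hS).
have nPf : ~~ (P <= perp Q)%VS.
  apply: contraNN nQr => PQ; apply: subv_trans jr.
  by rewrite -jE subv_cap Qp' (plane_perpl hS).
set f := (pi :&: perp Q)%VS.
have df : \dim f = 2%N := dim_foot hS pp pp' disj dQ Qp'.
have fp : (f <= pi)%VS by apply: capvSl.
pose G := points_of j :\: bad_points j.
have GP Y : Y \in G -> [/\ \dim Y = 1%N, (Y <= j)%VS & y Y = 2].
  rewrite !inE => /andP[+ /andP[/eqP dR Rj]].
  by rewrite dR Rj eqxx /= negbK => /eqP gR.
have PfR Y : \dim Y = 1%N -> (Y <= j)%VS -> (P <= pi :&: perp Y)%VS.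
  move=> dR Rj; rewrite subv_cap Pp (subv_trans Pr) // (polar_perp hS) //.
  exact: subv_trans jr.
(* The foot of Y passes through P and f does not, so they are different lines of pi and meet in a
   point. *)
have dimz Y : Y \in G -> \dim (f :&: perp Y) = 1%N.
  case/GP => dR Rj gR; have Rp' := subv_trans Rj jp'.
  have -> : (f :&: perp Y = f :&: (pi :&: perp Y))%VS.
    by rewrite capvA (capv_idPl fp).
  apply: (cap_lines_plane dpi) => //; first exact: (dim_foot hS pp pp').
    exact: capvSl.
  apply: contraNneq nPf => E; apply: subv_trans (PfR Y dR Rj) _.
  by rewrite -E capvSr.
pose phi Y := (f :&: perp Y + Q)%VS.
have zpi Y : (f :&: perp Y <= pi)%VS by apply: subv_trans fp; apply: capvSl.
have nzQ Y : Y \in G -> (f :&: perp Y)%VS != Q.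
  by move=> RG; apply: contraNneq nQpi => <-.
have phi_line Y : Y \in G -> phi Y \in lines_through Q (foot_plane perp pi Q).
  move=> RG; apply/lines_throughP; rewrite /phi dim_add_points ?dimz ?nzQ //.
  split=> //; first exact: addvSr.
  by rewrite addvS // capvSl.
have phi_on Y : Y \in G -> (2 <= planes_on (phi Y))%N.
  move=> RG; have [dphi Qphi phiT] := lines_throughP _ _ _ (phi_line Y RG).
  apply: planes_on_ge2 => //.
    exact: (plane_sub hS (foot_plane_in hS pp pp' disj dQ Qp') phiT).
  have [dR Rj gR] := GP Y RG; have Rp' := subv_trans Rj jp'.
  have TL := foot_plane_in_CL pL pL' rL disj gP dP Pp Pr dR Rp' (subv_trans Rj jr).
  have nRpi := disjoint_notin disj dR Rp'.
  have [||sigma [sL zs Rs ds]] :=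
    good_join gR dR TL pL' (foot_plane_cap hS pp pp' disj dR Rp') (dimz Y RG).
  - apply: subv_trans (addvSl _ _); rewrite subv_cap zpi.
    exact: capvSr.
  - by apply: contraNneq nRpi => <-.
  have [sS _] := planesP _ _ (CL_planes sL).
  apply: (planes_on_gt0 sL); rewrite subv_add zs.
  have zp := CL_point pL (dimz Y RG) (zpi Y).
  have nzpi' : ~~ (f :&: perp Y <= pi')%VS.
    by apply: disjoint_notin (zpi Y); rewrite ?dimz // capvC.
  (* By dimension sigma contains the whole line of pi' orthogonal to the point [f :&: perp Y], and Q
     is on that line. *)
  have sE : (sigma :&: pi')%VS = (pi' :&: perp (f :&: perp Y))%VS.
    apply: subv_dim_eq; last by rewrite ds (dim_plane_cap_perp hS).
    rewrite subv_cap capvSr (subv_trans (capvSl _ _)) //.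
    by rewrite (polar_perp hS) ?dimz.
  apply: subv_trans (capvSl sigma pi'); rewrite sE subv_cap Qp'.
  apply: (plane_perpl hS) => //; apply: subv_trans (capvSl _ _) _; exact: capvSr.
(* The line [phi Y] determines its point on pi, this point and P span the foot of Y, and the foot
   determines Y. *)
have phi_inj : {in G &, injective phi}.
  move=> Y1 Y2 G1 G2 E; have [dR1 Rj1 _] := GP _ G1; have [dR2 Rj2 _] := GP _ G2.
  have Rp1 := subv_trans Rj1 jp'; have Rp2 := subv_trans Rj2 jp'.
  have [d1 _ _] := lines_throughP _ _ _ (phi_line _ G1).
  have zE : (f :&: perp Y1 = f :&: perp Y2)%VS.
    apply/eqP; apply: contraNT nQpi => nz.
    apply: subv_trans (addvSr (f :&: perp Y1) Q) _; rewrite -/(phi Y1).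
    rewrite -(line_points d1 (dimz _ G1) (dimz _ G2) nz) ?addvSl //.
      by rewrite subv_add !zpi.
    by rewrite E addvSl.
  apply: (foot_inj hS pp pp' disj) => //.
  have nzP : P != (f :&: perp Y1)%VS.
    by apply: contraNneq nPf => ->; apply: subv_trans (capvSl _ _) _; apply: capvSr.
  have lineE Y : Y \in G -> (f :&: perp Y = f :&: perp Y1)%VS ->
      (P + f :&: perp Y1)%VS = (pi :&: perp Y)%VS.
    move=> RG zR; have [dR Rj _] := GP _ RG.
    apply: line_points; rewrite ?(dim_foot hS pp pp') ?dimz ?PfR //.
    - exact: subv_trans Rj jp'.
    - by rewrite -zR capvS.
  by rewrite -(lineE Y1) // -(lineE Y2).
have cG : #|points_of j|%:R = #|G|%:R + #|bad_points j|%:R :> R.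
  rewrite -natrD addnC -(cardsID (bad_points j) (points_of j)); congr (_ + _)%N%:R.
  by congr #|pred_of_set _|; apply/setIidPr/subsetP => Z; rewrite inE => /andP[].
have : (#|G| * 2 <= \sum_(l in lines_through Q (foot_plane perp pi Q)) planes_on l)%N.
  rewrite -(card_in_imset phi_inj) -sum_nat_const big_mkcond [leqRHS]big_mkcond.
  apply: leq_sum => l _; case: imsetP => [[Y RG ->]|] //=.
  by rewrite phi_line //= phi_on.
(* As G has at least q + 3 - x points, this gives 2(q + 3 - x) <= y(Q) <= x, against 2x <= q + 2. *)
rewrite -(ler_nat R) -(value_out (foot_plane_in hS pp pp' disj dQ Qp')) ?addvSr // natrM.
have := value_le_total Qp; move: badj cG; rewrite card_points_of2 // natrD.
move: x_small qR_gt1; lra.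
Qed.

(** Here tau is a second plane of L on a line l of pi, X a good point of tau off l, and pi' a plane
    of L meeting tau in X alone. Points of pi orthogonal to X are on l, inside tau, so pi' misses
    pi. The plane rho of L joins the good point P of l to X and meets pi' in a line. The last clause
    provides the line from which the total weight of the quadric is computed. *)
Lemma exists_regulus : L != set0 -> exists pi pi',
  [/\ pi \in L, pi' \in L, (pi :&: pi' = 0)%VS,
    forall Q, \dim Q = 1%N -> (Q <= pi')%VS -> foot_plane perp pi Q \in L
  & exists X, [/\ \dim X = 1%N, (X <= pi')%VS & planes_on (pi :&: perp X) = 2%N]].
Proof.
case/set0Pn => pi pL; have pp := CL_planes pL; have dp := plane_dim pp.
have [|P0 dP0 P0p] := @exists_point _ _ pi; first by rewrite dp.
have [l0 [/lines_throughP[dl0 _ _] _ _]] := exists_line_through P0 P0 dP0 dp P0p.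
have [P [dP Pp _ gP]] := exists_good_notin pL dl0.
have [l [/lines_throughP[dl Pl lp] _ _]] := exists_line_through P P dP dp Pp.
have [tau [tL lt ntp]] := second_plane gP dP dl pL Pl lp.
have [X [dX Xt nXl gX]] := exists_good_notin tL dl.
have tp := CL_planes tL.
have [pi' [_ [pL' _ capX _ _]]] := good_triple gX dX tL Xt.
have pp' := CL_planes pL'; have [piS' _] := planesP _ _ pp'.
have [tS _] := planesP _ _ tp.
have Xp' : (X <= pi')%VS by rewrite -capX capvSr.
have capl : (pi :&: tau)%VS = l := planes_cap_line pp tp ntp dl lp lt.
have nXp : ~~ (X <= pi)%VS.
  by apply: contraNN nXl => Xp; rewrite -capl subv_cap Xp.
have Xpt := CL_point tL dX Xt.
have footX : (pi :&: perp X)%VS = l.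
  apply/esym/subv_dim_eq; last by rewrite dl (dim_plane_cap_perp hS).
  by rewrite subv_cap lp (subv_trans lt) // (polar_perp hS).
have disj : (pi :&: pi' = 0)%VS.
  apply/eqP; apply: contraNT nXp; rewrite -subv0 => /exists_point_notin[Y [dY]].
  rewrite subv_cap => /andP[Yp Yp'] _.
  have YX : Y = X.
    apply: subv_dim_eq; last by rewrite dY.
    rewrite -capX subv_cap Yp' andbT; apply: subv_trans lt.
    by rewrite -footX subv_cap Yp (subv_trans Yp') // (polar_perp hS).
  by rewrite -YX.
have nPX : P != X by apply: contraNneq nXp => <-.
have [rho [rL Pr Xr dr]] := good_join gX dX tL pL' capX dP (subv_trans Pl lt) nPX.
exists pi, pi'; split=> //.
  by apply: (foot_planes_in_CL pL pL' rL disj gP dP Pp Pr dr gX dX); rewrite subv_cap Xr.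
by exists X; rewrite footX (good_planes_on gP dP dl pL).
Qed.

End NoPencil.

End CameronLiebler.

(** * Removing pencils and hyperbolic quadrics *)

Section Decomposition.

Variables (F : finFieldType) (n : nat) (S : {set {vspace 'rV[F]_n}}).
Variable perp : {vspace 'rV[F]_n} -> {vspace 'rV[F]_n}.
Hypothesis hS : polar_space S perp.
Variable R : realFieldType.
Local Notation q := #|F|.
Implicit Types (U W P Q l m pi : {vspace 'rV[F]_n}) (L H : {set {vspace 'rV[F]_n}}).
Implicit Type w : {vspace 'rV[F]_n} -> R.

Definition CL_weight w L : Prop :=
  L \subset planes S /\ forall pi, pi \in planes S -> weight S w pi = (pi \in L)%:R.

Definition pencil_free L : Prop := forall P, P \in points S ->
  exists pi, [/\ pi \in planes S, (P <= pi)%VS & pi \notin L].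

Lemma weightB w w' U : weight S (fun P => w P - w' P) U = weight S w U - weight S w' U.
Proof. by rewrite -sumrB; apply: eq_bigr => P _; rewrite mulrBl. Qed.

Lemma total_weightB w w' :
  total_weight S (fun P => w P - w' P) = total_weight S w - total_weight S w'.
Proof. exact: sumrB. Qed.

Lemma CL_weightD w w' L L' : CL_weight w L -> CL_weight w' L' -> L' \subset L ->
  CL_weight (fun P => w P - w' P) (L :\: L').
Proof.
move=> [LS wL] [_ wL'] sub; split; first by apply: subset_trans LS; apply: subsetDl.
move=> pi pp; rewrite weightB wL // wL' // inE.
case: (boolP (pi \in L')) => [/(subsetP sub) -> | _]; first by rewrite subrr.
by rewrite subr0.
Qed.

Lemma covered_plane_in_CL w L pi : CL_weight w L -> pencil_free L ->
  2 * total_weight S w <= q%:R + 2 -> pi \in planes S ->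
  (forall P, \dim P = 1%N -> (P <= pi)%VS -> exists2 tau, tau \in L & (P <= tau)%VS) ->
  pi \in L.
Proof.
move=> [LS wL] free small pp cover; apply: contraT => nL.
have := sum_point_value_plane hS w pp; rewrite wL // (negPf nL) mulr0 addr0 => E.
have : 2 * #|points_of pi|%:R <= \sum_(P in points_of pi) point_value S perp w P.
  rewrite mulr_natr -sumr_const; apply: ler_sum => P /points_ofP[dP Pp].
  have [tau tL Pt] := cover P dP Pp.
  exact: (value_ge2 hS LS wL free small tL dP Pt).
rewrite E (card_points_of3 (plane_dim pp)) !natrD natrX.
have : (1 : R) < q%:R by rewrite ltr1n card_finNzRing_gt1.
move: small; nra.
Qed.

Lemma exists_regulus_quadric w L : CL_weight w L -> pencil_free L ->
  2 * total_weight S w <= q%:R + 2 -> L != set0 -> regulus_quadrics S perp ->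
  exists H, [/\ embedded_hyperbolic_quadric S H, quadric_planes H \subset L,
    quadric_planes H != set0,
    forall P, P \in H -> exists2 U, U \in quadric_planes H & (P <= U)%VS
  & CL_weight (quadric_weight R H) (quadric_planes H) /\
    total_weight S (quadric_weight R H) = 2].
Proof.
move=> wL free small L0 quadrics; have [LS wLE] := wL.
have [pi [pi' [pL pL' disj TL [X [dX Xp' X2]]]]] := exists_regulus hS LS wLE free small L0.
have pp := CL_planes LS pL; have pp' := CL_planes LS pL'.
have [emb cutH] := quadrics pi pi' pp pp' disj.
set H := regulus_points perp pi pi' in emb cutH.
have HP P : P \in H -> exists2 Q, Q \in points_of pi' & (P <= foot_plane perp pi Q)%VS.
  by rewrite inE => /andP[_ /exists_inP[Q]]; exists Q.
have THq Q : Q \in points_of pi' -> foot_plane perp pi Q \in quadric_planes H.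
  move=> Qp'; have /points_ofP[dQ Qpi'] := Qp'.
  apply/quadric_planesP; first exact: plane_dim (foot_plane_in hS pp pp' disj dQ Qpi').
  by move=> P dP PT; rewrite inE dP eqxx; apply/exists_inP; exists Q.
have piHq : pi \in quadric_planes H.
  apply/quadric_planesP; first exact: plane_dim pp.
  move=> P dP Pp; rewrite inE dP eqxx; apply/exists_inP.
  have [|Q dQ] := @exists_point _ _ (pi' :&: perp P).
    by have := polar_codim hS pi' dP; rewrite (plane_dim pp') => /ltnW; case: (\dim _).
  rewrite subv_cap => /andP[Qp' QP]; exists Q; first exact/points_ofP.
  apply: subv_trans (addvSl _ _); rewrite subv_cap Pp.
  apply: (polar_sym hS) => //.
have HqS : quadric_planes H \subset planes S by case: emb.
have HqL : quadric_planes H \subset L.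
  apply/subsetP => U UH; have Up := subsetP HqS _ UH.
  apply: (covered_plane_in_CL wL free small Up) => P dP PU.
  have /(quadric_planesP H (plane_dim Up)) UH' := UH.
  have [Q /points_ofP[dQ Qp'] PT] := HP P (UH' P dP PU).
  by exists (foot_plane perp pi Q) => //; apply: TL.
have wH : CL_weight (quadric_weight R H) (quadric_planes H).
  by split=> // U Up; rewrite (weight_quadric hS).
exists H; split=> //.
- by apply/set0Pn; exists pi.
- by move=> P /HP[Q Qp' PT]; exists (foot_plane perp pi Q); rewrite ?THq.
split=> //; pose l := (pi :&: perp X)%VS.
have lp : (l <= pi)%VS by apply: capvSl.
have dl : \dim l = 2%N := dim_foot hS pp pp' disj dX Xp'.
have lS : l \in S := plane_sub hS pp lp.
have XP : X \in points_of pi' by apply/points_ofP.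
have lT : (l <= foot_plane perp pi X)%VS by apply: addvSl.
(* Both pi and the foot plane of X are planes of H on l, and L has no third plane there. *)
have lH : planes_on (quadric_planes H) l = 2%N.
  apply/eqP; rewrite eqn_leq -[X in (_ <= X)%N && _]X2; apply/andP; split.
    apply: subset_leq_card; apply/subsetP => U; rewrite !in_set -/l => /andP[UH ->].
    by rewrite andbT (subsetP HqL) // in_set.
  have nTp : pi != foot_plane perp pi X.
    apply: contraNneq (disjoint_notin disj dX Xp') => ->; exact: addvSr.
  have <- : #|[set pi; foot_plane perp pi X]| = 2%N by rewrite cards2 nTp.
  apply: subset_leq_card; apply/subsetP => U; rewrite in_set2 in_set => /orP[]/eqP->.
    by rewrite lp andbT.
  by rewrite lT andbT THq.
(* In a plane U outside the set of planes of H, the n of this set sum to its total weight. U meets H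
   in a line only, so l is the one line of U on planes of H, and it contributes 2. *)
have [U [Up lU nUL]] := exists_plane_out hS LS wLE free small lS dl.
have nUH : U \notin quadric_planes H by apply: contraNN nUL => /(subsetP HqL).
have [K [KU dK KH]] := quadric_cut cutH Up; rewrite (negPf nUH) addn0 in dK.
have [_ wHE] := wH.
have onK j : (j <= U)%VS -> (0 < planes_on (quadric_planes H) j)%N -> (j <= K)%VS.
  move=> jU /card_gt0P[V]; rewrite inE => /andP[VH jV].
  have dV := plane_dim (subsetP HqS _ VH).
  have /(quadric_planesP H dV) VHP := VH.
  apply: sub_points => P dP Pj; rewrite -KH ?(subv_trans Pj) //.
  by apply: VHP => //; apply: subv_trans jV.
have lK : l = K by apply: subv_dim_eq; rewrite ?dl ?dK // onK // lH.
have := sum_planes_on_plane hS HqS wHE Up; rewrite (negPf nUH) mulr0 addr0 => <-.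
rewrite (bigD1 l) /=; last by rewrite dl eqxx.
rewrite lH big1 // => j /andP[/andP[/eqP dj jU] njl]; apply/eqP; rewrite -leqn0 leqNgt.
apply: contraNN njl => /(onK j jU) jK; apply/eqP; rewrite lK.
by apply: subv_dim_eq; rewrite ?dj ?dK.
Qed.

Lemma no_grid_CL_set0 w L : CL_weight w L -> pencil_free L ->
  2 * total_weight S w <= q%:R + 2 -> no_grid S -> L = set0.
Proof.
move=> [LS wL] free small nogrid; apply/eqP; apply: contraT => /set0Pn[pi pL].
have pp := CL_planes LS pL; have dp := plane_dim pp.
have [|P0 dP0 P0p] := @exists_point _ _ pi; first by rewrite dp.
have [l0 [/lines_throughP[dl0 _ _] _ _]] := exists_line_through P0 P0 dP0 dp P0p.
have [P [dP Pp _ gP]] := exists_good_notin hS LS wL free small pL dl0.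
have [rho [sigma [rL sL pr ps rs]]] := good_triple hS LS wL free small gP dP pL Pp.
have [rp sp] := (CL_planes LS rL, CL_planes LS sL).
case: (nogrid P pi rho sigma dP pp rp sp pr ps rs) => l /lines_throughP[dl Pl lp].
have [tau [tL lt tr]] := good_transversal hS LS wL free small gP dP pL rL pr dl Pl lp.
have [tau' [tL' lt' ts']] := good_transversal hS LS wL free small gP dP pL sL ps dl Pl lp.
exists tau; split=> //; first exact: (CL_planes LS tL).
(* Besides pi only one plane of L contains l, so the transversals found for rho and for sigma
   coincide. *)
suff -> : tau = tau' by [].
have ntp : tau != pi by apply/eqP => E; move: tr; rewrite E pr dP.
have ntp' : tau' != pi by apply/eqP => E; move: ts'; rewrite E ps dP.
apply/eqP; apply: contraT => ntt.
have l2 := good_planes_on hS LS wL free small gP dP dl pL Pl lp.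
have : (#|[set pi; tau; tau']| <= planes_on L l)%N.
  apply: subset_leq_card; apply/subsetP => U.
  by rewrite !inE => /orP[/orP[]|] /eqP ->; rewrite ?pL ?tL ?tL'.
by rewrite l2 setUC cardsU1 cards2 !inE (eq_sym pi) ntp (negPf ntp') eq_sym (negPf ntt).
Qed.

Lemma remove_pencil w L P : CL_weight w L -> P \in points S -> point_pencil S P \subset L ->
  exists w', CL_weight w' (L :\: point_pencil S P) /\ total_weight S w' = total_weight S w - 1.
Proof.
move=> wL Pp sub; pose d Q : R := (Q == P)%:R.
have sumd (f : {vspace 'rV[F]_n} -> R) : \sum_(Q in points S) d Q * f Q = f P.
  rewrite (bigD1 P) //= /d eqxx mul1r big1 ?addr0 // => Q /andP[_ /negPf->].
  by rewrite mul0r.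
exists (fun Q => w Q - d Q); split.
  apply: CL_weightD => //; split; first by apply/subsetP => pi; rewrite inE => /andP[].
  by move=> pi pp; rewrite /weight sumd inE pp.
rewrite total_weightB; congr (_ - _); rewrite -[RHS](sumd (fun=> 1)).
by apply: eq_bigr => Q _; rewrite mulr1.
Qed.

(** Non-collinearity and P outside H are expressed by disjoint sets of planes, which is what
    successive removals yield. That every point of H lies on a plane of H permits the translation
    back. *)
Definition CL_decomposition w L (HH : {set {set {vspace 'rV[F]_n}}})
    (V : {set {vspace 'rV[F]_n}}) : Prop :=
  [/\ forall H, H \in HH -> [/\ embedded_hyperbolic_quadric S H, quadric_planes H != set0
        & forall P, P \in H -> exists2 U, U \in quadric_planes H & (P <= U)%VS],
      forall H H', H \in HH -> H' \in HH -> H != H' ->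
        [disjoint quadric_planes H & quadric_planes H'],
      V \subset points S /\ #|V|%:R = total_weight S w - 2 * #|HH|%:R,
      (forall P P', P \in V -> P' \in V -> P != P' ->
        [disjoint point_pencil S P & point_pencil S P']) /\
      (forall P H, P \in V -> H \in HH -> [disjoint point_pencil S P & quadric_planes H])
    & L = (\bigcup_(H in HH) quadric_planes H) :|: (\bigcup_(P in V) point_pencil S P)].

(** Induction on the number of planes of L, since the total weight is a real number; each removal
    takes away a nonempty set and keeps 2x <= q + 2. *)
Lemma exists_CL_decomposition w L : planes S != set0 ->
  regulus_quadrics S perp \/ no_grid S ->
  CL_weight w L -> 2 * total_weight S w <= q%:R + 2 ->
  exists HH V, CL_decomposition w L HH V /\ (no_grid S -> HH = set0).
Proof.
move=> S0 geom; have [k] := ubnP #|L|; elim: k => // k IH in w L *.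
rewrite ltnS => Lk wL small; have [LS wLE] := wL.
have [L0|L0] := eqVneq L set0.
  exists set0, set0; split=> //; split; rewrite ?big_set0 ?setU0 //.
  - by move=> H; rewrite inE.
  - by move=> H H'; rewrite inE.
  - by rewrite sub0set !cards0 (CL_set0_total hS LS wLE S0 L0) mulr0 subr0.
  - by split=> [P P'|P H]; rewrite inE.
have smaller L' : L' != set0 -> L' \subset L -> (#|L :\: L'| < k)%N.
  move=> L'0 sub; apply: leq_trans Lk; rewrite cardsD (setIidPr sub).
  by rewrite ltn_subrL !card_gt0 L'0.
have [/exists_inP[P Pp sub]|/exists_inPn nopencil] :=
    boolP [exists P in points S, point_pencil S P \subset L].
  have [_ dP] := pointsP _ _ Pp.
  have PP0 : point_pencil S P != set0.
    have [pi pp Ppi] := exists_plane_through hS Pp S0.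
    by apply/set0Pn; exists pi; rewrite inE pp.
  have [w' [wL' tw']] := remove_pencil wL Pp sub.
  have [|HH [V [[HHq HHd [VS cV] [Vd VHd] LE] nogrid]]] := IH w' _ (smaller _ PP0 sub) wL'.
    by rewrite tw'; move: small; lra.
  have dis (A : {set {vspace 'rV[F]_n}}) : A \subset L :\: point_pencil S P ->
      [disjoint point_pencil S P & A].
    move=> /subsetP As; rewrite disjoint_sym disjoint_subset; apply/subsetP => U /As.
    by rewrite in_setD => /andP[].
  have disV P' : P' \in V -> [disjoint point_pencil S P & point_pencil S P'].
    by move=> P'V; apply: dis; rewrite LE subsetU // (bigcup_sup P') ?orbT.
  have disH H : H \in HH -> [disjoint point_pencil S P & quadric_planes H].
    by move=> HHH; apply: dis; rewrite LE subsetU // (bigcup_sup H).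
  have PV : P \notin V.
    by apply/negP => /disV; rewrite -setI_eq0 setIid (negPf PP0).
  exists HH, (P |: V); split=> //; split=> //.
  - split; first by rewrite subUset sub1set Pp.
    by rewrite cardsU1 PV /= natrD cV tw'; ring.
  - split=> [P1 P2|P1 H]; rewrite !inE.
      move=> /predU1P[->|V1] /predU1P[->|V2] n12; rewrite ?eqxx // in n12 *.
      + exact: disV.
      + by rewrite disjoint_sym; apply: disV.
      + exact: Vd.
    by move=> /predU1P[->|V1] HHH; [apply: disH | apply: VHd].
  rewrite bigcup_setU big_set1 setUCA -LE.
  by rewrite -[LHS](setID L (point_pencil S P)) (setIidPr sub).
have free : pencil_free L.
  move=> P Pp; have /subsetPn[pi] := nopencil P Pp; rewrite inE => /andP[pp Ppi] nL.
  by exists pi.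
have [quadrics|nogrid] := geom; last first.
  by rewrite (no_grid_CL_set0 wL free small nogrid) eqxx in L0.
have [H [emb sub Hq0 Hcov [wH tH]]] := exists_regulus_quadric wL free small L0 quadrics.
have wL' := CL_weightD wL wH sub.
have [|HH [V [[HHq HHd [VS cV] [Vd VHd] LE] nogrid]]] := IH _ _ (smaller _ Hq0 sub) wL'.
  by rewrite total_weightB tH; move: small; lra.
have dis (A : {set {vspace 'rV[F]_n}}) : A \subset L :\: quadric_planes H ->
    [disjoint A & quadric_planes H].
  move=> /subsetP As; rewrite disjoint_subset; apply/subsetP => U /As.
  by rewrite in_setD => /andP[].
have disV P : P \in V -> [disjoint point_pencil S P & quadric_planes H].
  by move=> PV; apply: dis; rewrite LE subsetU // (bigcup_sup P) ?orbT.
have disH H' : H' \in HH -> [disjoint quadric_planes H' & quadric_planes H].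
  by move=> HHH; apply: dis; rewrite LE subsetU // (bigcup_sup H').
have HHH : H \notin HH.
  by apply/negP => /disH; rewrite -setI_eq0 setIid (negPf Hq0).
exists (H |: HH), V; split; last first.
  (* Without grids a nonempty L contains a full pencil, so the removal of a quadric never occurs. *)
  by move=> /(no_grid_CL_set0 wL free small) E; rewrite E eqxx in L0.
split=> //.
- by move=> H'; rewrite in_setU1 => /predU1P[->|/HHq].
- move=> H1 H2; rewrite !in_setU1.
  move=> /predU1P[->|V1] /predU1P[->|V2] n12; rewrite ?eqxx // in n12 *.
  + by rewrite disjoint_sym; apply: disH.
  + exact: disH.
  + exact: HHd.
- split=> //; rewrite cV total_weightB tH cardsU1 HHH /= natrD; ring.
- split=> // P H'; rewrite in_setU1 => PV /predU1P[->|]; first exact: disV.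
  exact: VHd.
rewrite bigcup_setU big_set1 -setUA -LE.
by rewrite -[LHS](setID L (quadric_planes H)) (setIidPr sub).
Qed.

End Decomposition.

(** * Polar spaces of forms *)

Section BilinearForms.

Variables (F : finFieldType) (n : nat).
Implicit Types (M J : 'M[F]_n) (u v x : 'rV[F]_n) (a : F) (U : {vspace 'rV[F]_n}).

Lemma bformDl M u1 u2 v : bform M (u1 + u2) v = bform M u1 v + bform M u2 v.
Proof. by rewrite /bform !mulmxDl mxE. Qed.

Lemma bformDr M u v1 v2 : bform M u (v1 + v2) = bform M u v1 + bform M u v2.
Proof. by rewrite /bform linearD mulmxDr mxE. Qed.

Lemma bformZl M a u v : bform M (a *: u) v = a * bform M u v.
Proof. by rewrite /bform -!scalemxAl mxE. Qed.

Lemma bformZr M a u v : bform M u (a *: v) = a * bform M u v.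
Proof. by rewrite /bform linearZ /= -scalemxAr mxE. Qed.

Lemma bform0l M v : bform M 0 v = 0.
Proof. by rewrite -(scale0r 0) bformZl mul0r. Qed.

Lemma bform0r M u : bform M u 0 = 0.
Proof. by rewrite -(scale0r 0) bformZr mul0r. Qed.

Lemma bformBr M u v1 v2 : bform M u (v1 - v2) = bform M u v1 - bform M u v2.
Proof. by rewrite bformDr -scaleN1r bformZr mulN1r. Qed.

Lemma bform_tr M u v : bform M^T u v = bform M v u.
Proof.
rewrite /bform; transitivity ((v *m M *m u^T)^T 0 0); last by rewrite mxE.
by rewrite !trmx_mul trmxK mulmxA.
Qed.

Lemma bform_addmx M J u v : bform (M + J) u v = bform M u v + bform J u v.
Proof. by rewrite /bform mulmxDr mulmxDl mxE. Qed.

Lemma polarizationE M u v : polarization M u v = bform (M + M^T) u v.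
Proof.
by rewrite bform_addmx bform_tr /polarization /qform bformDl !bformDr; ring.
Qed.

Lemma polarizationC M u v : polarization M u v = polarization M v u.
Proof. by rewrite /polarization [u + v]addrC; ring. Qed.

Lemma qformD M u v : qform M (u + v) = qform M u + qform M v + polarization M u v.
Proof. by rewrite /polarization; ring. Qed.

Lemma qformZ M a u : qform M (a *: u) = a ^+ 2 * qform M u.
Proof. by rewrite /qform bformZl bformZr; ring. Qed.

Lemma qform0 M : qform M 0 = 0.
Proof. exact: bform0l. Qed.

Lemma mem_line_add x v U : v \in (U + <[x]>)%VS -> exists2 u, u \in U & exists a, v = u + a *: x.
Proof. by case/memv_addP => u uU [_ /vlineP[a ->] ->]; exists u => //; exists a. Qed.

Lemma dim_rV k : \dim {:'rV[F]_k} = k.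
Proof. by rewrite dimvf /dim /= mul1n. Qed.

(** The right orthogonal of U, written as a kernel so that its dimension comes from rank and
    nullity. *)
Definition orth J (U : {vspace 'rV[F]_n}) : {vspace 'rV[F]_n} :=
  lker (linfun (mulmxr (\matrix_(i < \dim U) (vbasis U)`_i *m J)^T)).

Lemma orthP J U v : reflect (forall u, u \in U -> bform J u v = 0) (v \in orth J U).
Proof.
rewrite memv_ker lfunE /= ; set A := \matrix_i _.
have rowE i : (v *m (A *m J)^T) 0 i = bform J (vbasis U)`_i v.
  have <- : row i A = (vbasis U)`_i by apply: rowK.
  by rewrite /bform -!row_mul [RHS]mxE -[v in LHS]trmxK -trmx_mul [LHS]mxE.
apply: (iffP eqP) => [E u uU|h].
  rewrite (coord_vbasis uU); elim/big_rec: _ => [|i y _ IH]; first exact: bform0l.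
  by rewrite bformDl bformZl IH addr0 -rowE E mxE mulr0.
by apply/rowP => i; rewrite rowE mxE h // vbasis_mem // mem_nth ?size_tuple.
Qed.

Lemma dim_orth_ge J U : (n <= \dim (orth J U) + \dim U)%N.
Proof.
rewrite /orth; set f := linfun _.
have := limg_ker_dim f fullv; rewrite capfv dim_rV => E.
apply: leq_trans (_ : \dim (lker f) + \dim (limg f) <= _)%N; first by rewrite E.
by rewrite leq_add2l (leq_trans (dimvS (subvf _))) // dim_rV.
Qed.

(** Nondegeneracy is asked on U alone: in characteristic 2 the polarization of a parabolic quadric
    has a radical, whose nonzero vectors are not singular and so avoid every totally singular U. *)
Lemma dim_orth J U : (forall u, u \in U -> (forall v, bform J u v = 0) -> u = 0) ->
  (\dim (orth J U) + \dim U)%N = n.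
Proof.
move=> nondeg; rewrite /orth; set A := \matrix_i _; set f := linfun _.
have := limg_ker_dim f fullv; rewrite capfv dim_rV => E.
rewrite -[RHS]E; congr (_ + _)%N; suff -> : limg f = fullv by rewrite dim_rV.
have free : row_free (A *m J).
  apply: inj_row_free => c cAJ; have cU : c *m A \in U.
    rewrite mulmx_sum_row; apply: rpred_sum => i _; apply: rpredZ.
    by rewrite rowK vbasis_mem // mem_nth ?size_tuple.
  have : c *m A = 0.
    by apply: nondeg => // v; rewrite /bform -(mulmxA c A J) cAJ mul0mx mxE.
  rewrite mulmx_sum_row => cA0; apply/rowP => i; rewrite mxE.
  have := basis_free (vbasisP U) => /freeP; apply.
  by rewrite -[RHS]cA0; apply: eq_bigr => j _; rewrite rowK.
have /row_freeP[B AJB] := free.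
apply/eqP; rewrite eqEsubv subvf; apply/subvP => y _.
apply/memv_imgP; exists (y *m B^T); first exact: memvf.
by rewrite lfunE /= -mulmxA -trmx_mul AJB trmx1 mulmx1.
Qed.

Lemma dim_cap_orth J U W : \dim W = 1%N -> (\dim U <= (\dim (U :&: orth J W)).+1)%N.
Proof.
move=> dW; have := dimv_sum_cap U (orth J W); have := dim_orth_ge J W.
have := dimvS (subvf (U + orth J W)%VS); rewrite dim_rV dW.
by move: (\dim _) (\dim _) (\dim _) (\dim _) => *; lia.
Qed.

End BilinearForms.

(** The planes on l form a projective line over F, with pi as the point at infinity and f as the
    affine chart. *)
Lemma card_planes_on_param (F : finFieldType) (n : nat) (S : {set {vspace 'rV[F]_n}})
    (l pi : {vspace 'rV[F]_n}) (f : F -> {vspace 'rV[F]_n}) :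
  injective f -> pi \in planes S -> (l <= pi)%VS ->
  (forall a, [/\ f a \in planes S, (l <= f a)%VS & f a != pi]) ->
  (forall rho, rho \in planes S -> (l <= rho)%VS -> rho != pi -> exists a, rho = f a) ->
  #|[set rho in planes S | (l <= rho)%VS]| = (#|F| + 1)%N.
Proof.
move=> f_inj pp lp fP surj; rewrite (cardsD1 pi) inE pp lp /= addnC; congr (_ + _)%N.
rewrite -(card_imset _ f_inj); apply: eq_card => rho; rewrite in_setD1 in_set.
apply/and3P/imsetP => [[nrp rp lr]|[a _ ->]]; last by have [-> -> ->] := fP a.
by have [a ->] := surj rho rp lr nrp; exists a.
Qed.

(* [sing] is the set of singular vectors: everything in the symplectic case, the
   zeros of the quadratic form in the orthogonal case. *)
Record polar_form (F : finFieldType) (n : nat) (S : {set {vspace 'rV[F]_n}})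
    (J : 'M[F]_n) (sing : pred 'rV[F]_n) : Prop := PolarForm {
  polar_form_mem : forall U, U \in S <->
    (forall u, u \in U -> sing u) /\
    (forall u v, u \in U -> v \in U -> bform J u v = 0);
  polar_form_sym : forall u v, bform J u v = 0 -> bform J v u = 0;
  polar_form_scale : forall a u, sing u -> sing (a *: u);
  polar_form_add : forall u v, sing u -> sing v -> bform J u v = 0 -> sing (u + v);
  polar_form_iso : forall u, sing u -> bform J u u = 0;
  polar_form_nondeg : forall u, sing u -> (forall v, bform J u v = 0) -> u = 0
}.

(** * From a form to the polar space axioms *)

Section FormPolarSpace.

Variables (F : finFieldType) (n : nat) (S : {set {vspace 'rV[F]_n}}) (J : 'M[F]_n).
Variable sing : pred 'rV[F]_n.
Local Notation B := (bform J).
Local Notation perp := (orth J).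
Implicit Types (U W P Q l pi : {vspace 'rV[F]_n}) (u v x : 'rV[F]_n) (a : F).

Hypothesis hf : polar_form S J sing.
Let memS := polar_form_mem hf.
Let B_sym := polar_form_sym hf.
Let singZ := polar_form_scale hf.
Let singD := polar_form_add hf.
Let sing_iso := polar_form_iso hf.
Let nondeg := polar_form_nondeg hf.

Lemma subspace_sing U u : U \in S -> u \in U -> sing u.
Proof. by case/memS => h _; apply: h. Qed.

Lemma subspace_isotropic U u v : U \in S -> u \in U -> v \in U -> B u v = 0.
Proof. by case/memS => _; apply. Qed.

Lemma subspace_sub U W : U \in S -> (W <= U)%VS -> W \in S.
Proof.
move=> US /subvP WU; apply/memS; split=> [u uW|u v uW vW].
  exact: subspace_sing US (WU u uW).
by apply: subspace_isotropic US (WU u uW) (WU v vW).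
Qed.

Lemma sub_orthP U W :
  reflect (forall u v, u \in U -> v \in W -> B u v = 0) (W <= perp U)%VS.
Proof.
apply: (iffP subvP) => [h u v uU vW|h v vW].
  by have /orthP := h v vW; apply.
by apply/orthP => u uU; apply: h.
Qed.

Lemma sub_orthC U W : (W <= perp U)%VS -> (U <= perp W)%VS.
Proof. by move/sub_orthP => h; apply/sub_orthP => u v uW vU; apply/B_sym/h. Qed.

Lemma subspace_sub_orth U W W' : U \in S -> (W <= U)%VS -> (W' <= U)%VS -> (W <= perp W')%VS.
Proof.
move=> US /subvP WU /subvP WU'; apply/sub_orthP => u v /WU' uU /WU vU.
exact: subspace_isotropic US uU vU.
Qed.

Lemma subspace_join U x : U \in S -> sing x -> x \in perp U -> (U + <[x]>)%VS \in S.
Proof.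
move=> US sx /orthP xU; apply/memS; split=> [v|v v'].
  case/mem_line_add => u uU [a ->]; apply: singD; first exact: subspace_sing US uU.
    exact: singZ.
  by rewrite bformZr xU ?mulr0.
move=> /mem_line_add[u uU [a ->]] /mem_line_add[u' uU' [a' ->]].
rewrite bformDl !bformDr !bformZl !bformZr (subspace_isotropic US) // xU // sing_iso //.
by rewrite (B_sym (xU u' uU')) !mulr0 !addr0.
Qed.

Lemma dim_orth_subspace U : U \in S -> (\dim (perp U) + \dim U)%N = n.
Proof. by move=> US; apply: dim_orth => u uU; apply/nondeg/(subspace_sing US uU). Qed.

Lemma subspace_rank U : U \in S -> (2 * \dim U <= n)%N.
Proof.
move=> US; have dO := dim_orth_subspace US.
have := dimvS (subspace_sub_orth US (subvv U) (subvv U)).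
by rewrite mul2n -addnn => le; apply: leq_trans (_ : \dim (perp U) + \dim U <= n)%N;
  [rewrite leq_add2r | rewrite dO].
Qed.

(** With l' a complement of [l :&: pi] in l, the part of pi orthogonal to l has dimension at least 3
    - dim l', one more than [l :&: pi]. A vector of it outside l extends l to a plane. *)
Lemma exists_plane_on pi l : pi \in planes S -> l \in S -> \dim l = 2%N ->
  exists2 rho, rho \in planes S & (l <= rho)%VS.
Proof.
rewrite inE => /andP[pS /eqP dp] lS dl.
pose l' := (l :\: pi)%VS.
have dl' : (\dim (l :&: pi) + \dim l' = 2)%N by rewrite dimv_cap_compl.
have orth_l x : x \in pi -> x \in perp l' -> x \in perp l.
  move=> xp /orthP xl'; apply/orthP => u; rewrite -(addv_diff_cap l pi).
  case/memv_addP => u1 u1l [u2]; rewrite memv_cap => /andP[_ u2p] ->.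
  by rewrite bformDl xl' // (subspace_isotropic pS) // addr0.
have : (3 <= \dim (pi :&: perp l') + \dim l')%N.
  have := dimv_sum_cap pi (perp l'); rewrite dp => E.
  have := dim_orth_ge J l'; have := dimvS (subvf (pi + perp l')%VS); rewrite dim_rV.
  by move: E; move: (\dim _) (\dim _) (\dim _) (\dim _) => *; lia.
move=> d3; have [sub|] := boolP (pi :&: perp l' <= l)%VS.
  have := dimvS (_ : pi :&: perp l' <= l :&: pi)%VS; rewrite subv_cap sub capvSl => /(_ isT).
  by move: d3 dl'; move: (\dim _) (\dim _) (\dim _) => *; lia.
case/subvPn => x; rewrite memv_cap => /andP[xp xl'] nxl.
exists (l + <[x]>)%VS; last exact: addvSl.
rewrite inE subspace_join ?orth_l ?(subspace_sing pS xp) //=.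
by rewrite dim_add1 ?dl // dim_vline; case: eqP nxl => // ->; rewrite mem0v.
Qed.

Lemma form_polar_space : (n <= 7)%N ->
  (forall l, l \in S -> \dim l = 2%N ->
    #|[set pi in planes S | (l <= pi)%VS]| = (#|F| + 1)%N) ->
  polar_space S perp.
Proof.
move=> n7 lines; split=> //.
- exact: subspace_sub.
- by move=> U Q US _ QU; apply: subspace_sub_orth US _ QU.
- move=> U Q US /pointsP[QS dQ] UQ; rewrite -(dim1_vpick dQ); apply: subspace_join => //.
    exact: subspace_sing QS (memv_pick Q).
  by rewrite memvE dim1_vpick // sub_orthC.
- by move=> P Q _ _; apply: sub_orthC.
- by move=> U Q; apply: dim_cap_orth.
- by move=> U /subspace_rank; move: n7; lia.
Qed.

End FormPolarSpace.

Lemma dim_add_vector (F : finFieldType) (n : nat) (U : {vspace 'rV[F]_n}) x :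
  x \notin U -> \dim (U + <[x]>) = (\dim U).+1.
Proof.
move=> nxU; rewrite dim_add1 //.
by rewrite dim_vline; case: eqP nxU => // ->; rewrite mem0v.
Qed.

Lemma add_vector_eq (F : finFieldType) (n : nat) (U W : {vspace 'rV[F]_n}) x :
  (U <= W)%VS -> x \in W -> x \notin U -> \dim W = (\dim U).+1 -> (U + <[x]>)%VS = W.
Proof.
move=> UW xW nxU dW; apply: subv_dim_eq; first by rewrite subv_add UW -memvE.
by rewrite dim_add_vector.
Qed.

Lemma card_field_pow (F : finFieldType) :
  exists p k, [/\ prime p, p%:R = 0 :> F & #|F| = (p ^ k)%N].
Proof.
have [p pr_p pF] := finPcharP F; have cF := card_pprimeChar pF.
by exists p; eexists; split=> //; [exact: pcharf0 pF | exact: cF].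
Qed.

Lemma odd_field_two_neq0 (F : finFieldType) : odd #|F| -> 2%:R != 0 :> F.
Proof.
have [p [k [pr_p p0 cF]]] := card_field_pow F.
have k0 : (0 < k)%N by rewrite lt0n; apply: contraTneq (card_finNzRing_gt1 F) => k0; rewrite cF k0.
rewrite cF oddX -leqn0 leqNgt k0 /= => p_odd; apply/eqP => F2.
have : p%:R = 1 :> F.
  by rewrite -(odd_double_half p) p_odd add1n -muln2 -natr1 natrM F2 mulr0 add0r.
by rewrite p0 => /eqP; rewrite eq_sym oner_eq0.
Qed.

Lemma even_field_two_eq0 (F : finFieldType) : ~~ odd #|F| -> 2%:R = 0 :> F.
Proof.
have [p [k [pr_p p0 cF]]] := card_field_pow F.
by rewrite cF oddX negb_or => /andP[_]; case: (even_prime pr_p) p0 => [->|->].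
Qed.

(** * The symplectic space W(5,q) *)

Section Symplectic.

Variables (F : finFieldType) (J : 'M[F]_6).
Local Notation B := (bform J).
Local Notation S := [set U | totally_isotropic J U].
Hypothesis alt : forall v, B v v = 0.
Hypothesis J_unit : J \in unitmx.

Lemma bform_anti u v : B u v = - B v u.
Proof.
by apply/eqP; rewrite -addr_eq0 -(alt (u + v)) bformDl !bformDr !alt add0r addr0.
Qed.

Lemma symplectic_polar_form : polar_form S J predT.
Proof.
split=> // [U|u v|u _ h].
- rewrite inE; split=> [/forall_inP h|[_ h]].
    by split=> // u v uU vU; have /forall_inP/(_ v vU)/eqP := h u uU.
  by apply/forall_inP => u uU; apply/forall_inP => v vU; rewrite h.
- by rewrite bform_anti => /eqP; rewrite oppr_eq0 => /eqP.
suff uJ : u *m J = 0 by rewrite -(mulmxK J_unit u) uJ mul0mx.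
apply/rowP => i; rewrite [RHS]mxE; have := h (delta_mx 0 i).
by rewrite /bform trmx_delta -colE mxE.
Qed.
Let hf := symplectic_polar_form.

Lemma card_planes_symplectic l : planes S != set0 -> l \in S -> \dim l = 2%N ->
  #|[set pi in planes S | (l <= pi)%VS]| = (#|F| + 1)%N.
Proof.
case/set0Pn => pi0 pp0 lS dl.
have [pi pp lp] := exists_plane_on hf pp0 lS dl.
have [piS dpi] := planesP _ _ pp.
have /subvPn[v vp nvl] : ~~ (pi <= l)%VS by apply/negP => /dimvS; rewrite dl dpi.
have piE : (l + <[v]>)%VS = pi by apply: add_vector_eq; rewrite ?dl.
have pE : (pi <= orth J l)%VS by apply: (subspace_sub_orth hf piS).
have dE : \dim (orth J l) = 4%N.
  by have := dim_orth_subspace hf lS; rewrite dl => /eqP; rewrite (eqn_add2r 2 _ 4) => /eqP.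
have /subvPn[u uE nup] : ~~ (orth J l <= pi)%VS by apply/negP => /dimvS; rewrite dE dpi.
have EE : (pi + <[u]>)%VS = orth J l by apply: add_vector_eq; rewrite ?dE ?dpi.
have uvl w : w \in l -> B w u = 0 by have /orthP := uE; apply.
have vvl w : w \in l -> B w v = 0 by have /orthP := subvP pE v vp; apply.
have Bvu : B v u != 0.
  apply/negP => /eqP vu; have piu : (pi + <[u]>)%VS \in S.
    apply: (subspace_join hf) => //; apply/orthP => w; rewrite -piE => /mem_line_add[w' w'l [a ->]].
    by rewrite bformDl bformZl uvl // vu mulr0 addr0.
  have := subspace_rank hf piu; by rewrite dim_add_vector ?dpi.
(* Modulo l the orthogonal of l is a hyperbolic plane spanned by v and u, all of whose points are
   isotropic. Those other than v are the u + a v, and B (u + a v) (u + b v) = (a - b) B v u makes f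
   injective. *)
pose z a := u + a *: v; pose f a := (l + <[z a]>)%VS.
have znp a : z a \notin pi.
  by apply: contraNN nup => zp; rewrite -(addrK (a *: v) u) rpredB // rpredZ.
have fP a : [/\ f a \in planes S, (l <= f a)%VS & f a != pi].
  rewrite addvSl; split=> //.
    apply/planesP; rewrite dim_add_vector ?dl; last first.
      by apply: contraNN (znp a); apply: subvP.
    split=> //; apply: (subspace_join hf) => //; apply/orthP => w wl.
    by rewrite bformDr bformZr uvl // vvl // mulr0 addr0.
  by apply: contraNneq (znp a) => <-; rewrite memvE addvSr.
apply: (card_planes_on_param (f := f) _ pp lp fP) => [a b fab|rho rp lr nrp].
  have [faS _] := planesP _ _ (let: And3 h _ _ := fP a in h).
  have zz : B (z a) (z b) = 0.
    by apply: (subspace_isotropic hf faS); [|rewrite fab]; rewrite memvE addvSr.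
  apply/eqP; rewrite -subr_eq0 -(mulIr_eq0 _ (mulIf Bvu)); apply/eqP.
  move: zz; rewrite bformDl !bformDr !bformZl !bformZr !alt (bform_anti u v) => <-; ring.
have [rS dr] := planesP _ _ rp.
have /subvPn[x xr nxp] : ~~ (rho <= pi)%VS.
  by apply: contraNN nrp => rpi; rewrite eqEdim rpi dr dpi.
have : x \in orth J l.
  by apply: (subvP (subspace_sub_orth hf rS (subvv rho) lr)).
rewrite -EE => /mem_line_add[y]; rewrite -piE => /mem_line_add[w wl [a ->]] [b xE].
have b0 : b != 0.
  apply: contraNneq nxp => b0; rewrite xE b0 scale0r addr0 -piE.
  by rewrite memv_add // memvZ // memv_line.
exists (a / b); have zr : z (a / b) \in rho.
  have -> : z (a / b) = b^-1 *: (x - w).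
    have -> : x - w = a *: v + b *: u by rewrite xE -[w + a *: v + b *: u]addrA [w + _]addrC addrK.
    by rewrite scalerDr !scalerA mulVf // scale1r addrC mulrC.
  by rewrite memvZ // memvB // (subvP lr).
apply/esym/add_vector_eq; rewrite ?dl //.
by apply: contraNN (znp (a / b)); apply: subvP.
Qed.

Lemma symplectic_polar_space : planes S != set0 -> polar_space S (orth J).
Proof.
move=> S0; apply: (form_polar_space hf) => // l lS dl.
exact: card_planes_symplectic.
Qed.

(* If a + a', b + b' and a + b + c' in sigma lie on transversals, then c' = a' + b'
   modulo P, so B a b' + B b a' = 0, whereas sigma being isotropic gives
   B a b' - B b a' = 0. *)
Lemma symplectic_no_grid : odd #|F| -> no_grid S.
Proof.
move=> oddF P pi rho sigma dP pp rp sp pr ps rs grid.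
have [piS dpi] := planesP _ _ pp; have [rS dr] := planesP _ _ rp.
have [sS ds] := planesP _ _ sp.
have partner a : a \in pi -> a \notin P ->
    exists a', [/\ a' \in rho, a + a' \in sigma & B a a' = 0].
  move=> ap naP; have [|tau [tp lt tr ts]] := grid (P + <[a]>)%VS.
    apply/lines_throughP; rewrite dim_add_vector ?dP // addvSl subv_add -memvE ap.
    by rewrite -pr capvSl.
  have [tS dt] := planesP _ _ tp.
  have at_ : a \in tau by apply: (subvP lt); rewrite memvE addvSr.
  (* A vector of tau and sigma outside P has a nonzero component along a, since otherwise it would
     lie in rho and sigma, that is in P; it is scaled to make this component a. *)
  have /subvPn[s] : ~~ (tau :&: sigma <= P)%VS by apply/negP => /dimvS; rewrite dP ts.
  rewrite memv_cap => /andP[st ss] nsP.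
  have tE : (tau :&: rho + <[a]>)%VS = tau.
    apply: add_vector_eq; rewrite ?capvSl ?tr ?dt //.
    by apply: contraNN naP; rewrite memv_cap -pr memv_cap ap => /andP[].
  move: (st); rewrite -{1}tE => /mem_line_add[a1]; rewrite memv_cap => /andP[a1t a1r] [c sE].
  have c0 : c != 0.
    apply: contraNneq nsP => c0; rewrite -rs memv_cap ss andbT.
    by rewrite sE c0 scale0r addr0.
  exists (c^-1 *: a1); split; first exact: memvZ.
    have -> : a + c^-1 *: a1 = c^-1 *: s by rewrite sE scalerDr scalerA mulVf // scale1r addrC.
    exact: memvZ.
  by rewrite bformZr (subspace_isotropic hf tS) ?mulr0.
have Ppi : (P <= pi)%VS by rewrite -pr capvSl.
have /subvPn[a ap naP] : ~~ (pi <= P)%VS by apply/negP => /dimvS; rewrite dP dpi.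
have /subvPn[b bp nbPa] : ~~ (pi <= P + <[a]>)%VS.
  by apply/negP => /dimvS; rewrite dpi dim_add_vector ?dP.
have naPa : a \in (P + <[a]>)%VS by rewrite memvE addvSr.
have nbP : b \notin P by apply: contraNN nbPa => /(subvP (addvSl _ _)); apply.
have nabP : a + b \notin P.
  apply: contraNN nbPa => /(subvP (addvSl P <[a]>%VS)) abPa.
  by rewrite -(addKr a b) addrC memvB.
have [a' [a'r as_ aa']] := partner a ap naP.
have [b' [b'r bs bb']] := partner b bp nbP.
have [c' [c'r cs cc']] := partner (a + b) (memvD ap bp) nabP.
have dP' : c' - (a' + b') \in P.
  rewrite -rs memv_cap; apply/andP; split; first by rewrite memvB ?memvD.
  have -> : c' - (a' + b') = (a + b + c') - ((a + a') + (b + b')).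
    by apply/esym; rewrite [a + a' + _]addrACA opprD addrACA subrr add0r.
  by apply: memvB => //; apply: memvD.
have zero u v U : U \in S -> u \in U -> v \in U -> B u v = 0.
  by move=> US; apply: (subspace_isotropic hf US).
have E1 : B a b' + B b a' = 0.
  have : B (a + b) (c' - (a' + b')) = 0.
    by apply: (zero _ _ pi) => //; [rewrite memvD | apply: (subvP Ppi)].
  rewrite bformBr cc' sub0r => /eqP; rewrite oppr_eq0 bformDl !bformDr aa' bb' add0r addr0.
  by move/eqP.
have E2 : B a b' - B b a' = 0.
  have := zero _ _ _ sS as_ bs; rewrite bformDl !bformDr (zero a b pi) //.
  by rewrite (zero a' b' rho) // add0r addr0 (bform_anti a' b).
have ab' : B a b' = 0.
  have : 2%:R * B a b' = 0.
    by rewrite mulr_natl mulr2n -[X in X + _](addrNK (B b a')) E2 add0r addrC.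
  move/eqP; rewrite mulf_eq0 => /orP[|/eqP //].
  by rewrite (negPf (odd_field_two_neq0 oddF)).
(* Being orthogonal to P, a and b, the vector b' is orthogonal to pi, hence in pi and rho, so in P.
   Then b = (b + b') - b' is in sigma and pi, so in P, which is absurd. *)
have b'pi : b' \in pi.
  have b'pO : b' \in orth J pi.
    have PaE : (P + <[a]> + <[b]>)%VS = pi.
      apply: add_vector_eq; rewrite ?dim_add_vector ?dP //.
      by rewrite subv_add Ppi -memvE.
    apply/orthP => w; rewrite -PaE => /mem_line_add[w1 /mem_line_add[w2 w2P [c ->]] [d ->]].
    rewrite !bformDl !bformZl ab' bb' !mulr0 !addr0; apply: (zero _ _ rho) => //.
    by apply: subvP w2P; rewrite -pr capvSr.
  apply: contraT => nb'; have := subspace_rank hf (subspace_join hf piS isT b'pO).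
  by rewrite dim_add_vector ?dpi.
have b'P : b' \in P by rewrite -pr memv_cap b'pi.
case/negP: nbP; rewrite -ps memv_cap bp -(addrK b' b) memvB //.
by apply: subvP b'P; rewrite -ps capvSr.
Qed.

End Symplectic.

(** * The parabolic quadric Q(6,q) *)

Section Parabolic.

Variables (F : finFieldType) (M : 'M[F]_7).
Local Notation Q := (qform M).
Local Notation J := (M + M^T).
Local Notation B := (bform J).
Local Notation S := [set U | totally_singular M U].
Hypothesis nondegM : nondegenerate_on M fullv.

Lemma qform_add u v : Q (u + v) = Q u + Q v + B u v.
Proof. by rewrite qformD polarizationE. Qed.

Lemma bformC u v : B u v = B v u.
Proof. by rewrite -!polarizationE polarizationC. Qed.

Lemma bform_self u : B u u = 2 * Q u.
Proof. by rewrite bform_addmx bform_tr /qform; ring. Qed.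

Lemma parabolic_polar_form : polar_form S J (fun v => Q v == 0).
Proof.
split=> [U|u v|a u /eqP u0|u v /eqP u0 /eqP v0 uv|u /eqP u0|u /eqP u0 h].
- rewrite inE; split=> [/forall_inP h|[h _]]; last by apply/forall_inP.
  split=> // u v uU vU; have := qform_add u v.
  by rewrite (eqP (h _ uU)) (eqP (h _ vU)) (eqP (h _ (memvD uU vU))) !add0r.
- by rewrite bformC.
- by rewrite qformZ u0 mulr0.
- by rewrite qform_add u0 v0 uv !addr0.
- by rewrite bform_self u0 mulr0.
by apply: nondegM => [||//]; rewrite ?memvf // => w _; rewrite polarizationE.
Qed.
Let hf := parabolic_polar_form.

(* Modulo l the orthogonal of l is a 3-space with hyperbolic pair (v, u) and t
   orthogonal to both; the singular points of this conic other than v are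
   u + a t - a^2 Q(t) v. *)
Lemma card_planes_parabolic l : planes S != set0 -> l \in S -> \dim l = 2%N ->
  #|[set pi in planes S | (l <= pi)%VS]| = (#|F| + 1)%N.
Proof.
case/set0Pn => pi0 pp0 lS dl.
have [pi pp lp] := exists_plane_on hf pp0 lS dl.
have [piS dpi] := planesP _ _ pp.
have /subvPn[v vp nvl] : ~~ (pi <= l)%VS by apply/negP => /dimvS; rewrite dl dpi.
have piE : (l + <[v]>)%VS = pi by apply: add_vector_eq; rewrite ?dl.
have pE : (pi <= orth J l)%VS by apply: (subspace_sub_orth hf piS).
have dE : \dim (orth J l) = 5%N.
  by have := dim_orth_subspace hf lS; rewrite dl => /eqP; rewrite (eqn_add2r 2 _ 5) => /eqP.
have dpO : \dim (orth J pi) = 4%N.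
  by have := dim_orth_subspace hf piS; rewrite dpi => /eqP; rewrite (eqn_add2r 3 _ 4) => /eqP.
have pipO : (pi <= orth J pi)%VS by apply: (subspace_sub_orth hf piS).
have pOE : (orth J pi <= orth J l)%VS.
  by apply/sub_orthP => w z wl; apply/(sub_orthP _ _ _ (subvv (orth J pi)))/(subvP lp).
have /subvPn[u0 u0E nu0] : ~~ (orth J l <= orth J pi)%VS.
  by apply/negP => /dimvS; rewrite dE dpO.
have lE x w : x \in orth J l -> w \in l -> B w x = 0 by move=> /orthP; apply.
have Bvu0 : B v u0 != 0.
  apply: contraNneq nu0 => vu0; apply/orthP => w; rewrite -piE => /mem_line_add[w' w'l [a ->]].
  by rewrite bformDl bformZl (lE u0) // vu0 mulr0 addr0.
have Qv : Q v = 0 by apply/eqP/(subspace_sing hf piS vp).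
(* As Q v = 0 and B v u1 = 1, subtracting [Q u1 *: v] from u1 makes it singular. *)
have [u [uE Qu Bvu]] : exists u, [/\ u \in orth J l, Q u = 0 & B v u = 1].
  have [u1 u1E Bvu1] : exists2 u1, u1 \in orth J l & B v u1 = 1.
    by exists ((B v u0)^-1 *: u0); [exact: memvZ | rewrite bformZr mulVf].
  exists (u1 - Q u1 *: v); split.
  - by rewrite memvB // memvZ // (subvP pE).
  - by rewrite qform_add -scaleNr qformZ Qv bformZr bformC Bvu1 ; ring.
  - by rewrite bformBr bformZr Bvu1 bform_self Qv !mulr0 subr0.
have nul : u \notin orth J pi.
  by apply/negP => /orthP/(_ v vp); rewrite Bvu => /eqP; rewrite oner_eq0.
have [t [tpO But ntl]] : exists t, [/\ t \in orth J pi, B u t = 0 & t \notin l].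
  have /subvPn[t] : ~~ (orth J pi :&: orth J <[u]> <= l)%VS.
    have du : \dim <[u]> = 1%N by rewrite dim_vline; case: eqP nul => // ->; rewrite mem0v.
    have := dim_cap_orth J (orth J pi) du; rewrite dpO ltnS => ge3.
    by apply/negP => /dimvS; rewrite dl leqNgt ge3.
  rewrite memv_cap => /andP[tpO /orthP tu] ntl; exists t; split=> //.
  by apply: tu; apply: memv_line.
have ntp : t \notin pi.
  apply: contraNN ntl; rewrite -piE => /mem_line_add[w wl [a tE]].
  suff a0 : a = 0 by rewrite tE a0 scale0r addr0.
  by rewrite -But tE bformDr bformZr bformC (lE u) // (bformC u v) Bvu add0r mulr1.
have pOtE : (pi + <[t]>)%VS = orth J pi by apply: add_vector_eq; rewrite ?dpO ?dpi.
have EE : (orth J pi + <[u]>)%VS = orth J l by apply: add_vector_eq; rewrite ?dE ?dpO.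
have Qt : Q t != 0.
  apply/negP => Qt; have := subspace_rank hf (subspace_join hf piS Qt tpO).
  by rewrite dim_add_vector ?dpi.
have tE : t \in orth J l := subvP pOE t tpO.
have vE : v \in orth J l := subvP pE v vp.
have Bvt : B v t = 0 by have /orthP := tpO; apply.
have Bvv : B v v = 0 by rewrite bform_self Qv mulr0.
have Buu : B u u = 0 by rewrite bform_self Qu mulr0.
have qz b a c : Q (b *: u + a *: t + c *: v) = a ^+ 2 * Q t + b * c.
  rewrite !qform_add !qformZ Qu Qv !bformDl !bformZl !bformZr But (bformC t v) Bvt (bformC u v) Bvu.
  by ring.
pose z a := 1 *: u + a *: t + (- (a ^+ 2 * Q t)) *: v.
have Qz a : Q (z a) = 0 by rewrite qz; ring.
have zE a : z a \in orth J l by rewrite !memvD ?memvZ.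
pose f a := (l + <[z a]>)%VS.
have Bvz a : B v (z a) = 1.
  by rewrite !bformDr !bformZr Bvu Bvt Bvv; ring.
have znp a : z a \notin pi.
  apply/negP => zp; have /eqP := Bvz a.
  by rewrite (subspace_isotropic hf piS vp zp) eq_sym oner_eq0.
have fP a : [/\ f a \in planes S, (l <= f a)%VS & f a != pi].
  rewrite addvSl; split=> //.
    apply/planesP; rewrite dim_add_vector ?dl; last first.
      by apply: contraNN (znp a); apply: subvP.
    by split=> //; apply: (subspace_join hf) => //; apply/eqP.
  by apply: contraNneq (znp a) => <-; rewrite memvE addvSr.
apply: (card_planes_on_param (f := f) _ pp lp fP) => [a b fab|rho rp lr nrp].
  have [faS _] := planesP _ _ (let: And3 h _ _ := fP a in h).
  have zz : B (z a) (z b) = 0.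
    by apply: (subspace_isotropic hf faS); [|rewrite fab]; rewrite memvE addvSr.
  (* [B (z a) (z b)] is [- Q t * (a - b) ^+ 2]. *)
  have : Q t * (a - b) ^+ 2 = 0.
    rewrite -[RHS]oppr0 -zz !bformDl !bformDr !bformZl !bformZr.
    rewrite Buu Bvv Bvt But (bformC u v) Bvu (bformC t v) Bvt (bformC t u) But (bform_self t).
    ring.
  by move/eqP; rewrite mulf_eq0 (negPf Qt) sqrf_eq0 subr_eq0 => /eqP.
have [rS dr] := planesP _ _ rp.
have /subvPn[x xr nxp] : ~~ (rho <= pi)%VS.
  by apply: contraNN nrp => rpi; rewrite eqEdim rpi dr dpi.
have : x \in orth J l by apply: (subvP (subspace_sub_orth hf rS (subvv rho) lr)).
rewrite -EE => /mem_line_add[y]; rewrite -pOtE => /mem_line_add[y']; rewrite -piE.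
move=> /mem_line_add[w wl [c ->]] [a ->] [b xE].
have xwE : x - w = b *: u + a *: t + c *: v.
  rewrite xE; apply/eqP; rewrite subr_eq; apply/eqP.
  by rewrite [LHS]addrC (addrC (w + c *: v)) (addrC w) !addrA.
have xwr : x - w \in rho by rewrite memvB // (subvP lr).
have := subspace_sing hf rS xwr; rewrite xwE qz => /eqP conic.
(* On the conic a^2 Q(t) + b c = 0 the case b = 0 forces a = 0, which is the point v and would put x
   in pi. *)
have b0 : b != 0.
  apply: contraNneq nxp => b0; move: conic; rewrite b0 mul0r addr0 => /eqP.
  rewrite mulf_eq0 (negPf Qt) orbF sqrf_eq0 => /eqP a0.
  rewrite xE b0 a0 !scale0r !addr0 -piE.
  by rewrite memv_add // memvZ // memv_line.
exists (a / b); have zr : z (a / b) \in rho.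
  have -> : z (a / b) = b^-1 *: (x - w).
    rewrite xwE !scalerDr !scalerA mulVf // [a / b]mulrC; congr (_ + _ *: _).
    have -> : c = - (a ^+ 2 * Q t) / b.
      by apply: (mulfI b0); rewrite mulrCA divff // mulr1; apply/eqP; rewrite -addr_eq0 addrC conic.
    by field.
  by rewrite memvZ.
apply/esym/add_vector_eq; rewrite ?dl //.
by apply: contraNN (znp (a / b)); apply: subvP.
Qed.

Lemma parabolic_polar_space : planes S != set0 -> polar_space S (orth J).
Proof.
move=> S0; apply: (form_polar_space hf) => // l lS dl.
exact: card_planes_parabolic.
Qed.

End Parabolic.

Lemma totally_singular_line (F : finFieldType) (n : nat) (M : 'M[F]_n) x :
  totally_singular M <[x]> = (qform M x == 0).
Proof.
apply/forall_inP/eqP => [h|x0 _ /vlineP[a ->]]; first by apply/eqP/h/memv_line.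
by rewrite qformZ x0 mulr0.
Qed.

(** * The hyperbolic quadric of two disjoint planes *)

Section RegulusQuadric.

Variables (F : finFieldType) (n : nat) (S : {set {vspace 'rV[F]_n}}) (J : 'M[F]_n).
Variable sing : pred 'rV[F]_n.
Hypothesis hf : polar_form S J sing.
Hypothesis hS : polar_space S (orth J).
Variables (pi pi' : {vspace 'rV[F]_n}) (N : 'M[F]_n).
Hypotheses (pp : pi \in planes S) (pp' : pi' \in planes S).
Hypothesis disj : (pi :&: pi' = 0)%VS.
Hypothesis N_pi : forall u, u \in pi -> qform N u = 0.
Hypothesis N_pi' : forall u, u \in pi' -> qform N u = 0.
Hypothesis N_polar : forall u v, u \in pi -> v \in pi' -> polarization N u v = bform J u v.
Local Notation W := (pi + pi')%VS.

(** On u + v, with u in pi and v in pi', the form N takes the value B u v, so a singular point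
    spanned by u + v lies in the foot plane of the point spanned by v; for v = 0 any point of pi'
    orthogonal to u serves. N is the given form for Q(6,q) and a constructed one for W(5,q), q
    even. *)
Lemma regulus_pointsE :
  regulus_points (orth J) pi pi' =
  [set P | [&& \dim P == 1%N, (P <= W)%VS & totally_singular N P]].
Proof.
apply/setP => P; rewrite !in_set; case: eqP => //= dP.
apply/exists_inP/andP => [[Q /points_ofP[dQ Qp'] PT]|].
  rewrite -(dim1_vpick dP) totally_singular_line -memvE; have := memv_pick P.
  move: (vpick P) => x /(subvP PT); rewrite /foot_plane -(dim1_vpick dQ).
  have sp' : vpick Q \in pi' by apply: (subvP Qp'); apply: memv_pick.
  case/mem_line_add => u; rewrite memv_cap dim1_vpick // => /andP[up /orthP uQ] [a ->].
  have ap' : a *: vpick Q \in pi' by apply: memvZ.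
  rewrite memv_add // qformD N_pi // N_pi' // N_polar // bformZr.
  by rewrite (polar_form_sym hf (uQ _ (memv_pick Q))) mulr0 !addr0.
case; rewrite -(dim1_vpick dP) totally_singular_line -memvE; have := vpick_neq0 (_ : 0 < \dim P)%N.
rewrite dP => /(_ isT); move: (vpick P) => x x0.
case/memv_addP => u up [v vp' xE] /eqP Nx.
have uv : bform J u v = 0.
  by move: Nx; rewrite xE qformD N_pi // N_pi' // N_polar // !add0r.
have [s [sp' s0 us vs]] : exists s, [/\ s \in pi', s != 0, bform J u s = 0 & v \in <[s]>%VS].
  have [v0|v0] := eqVneq v 0; last by exists v; rewrite memv_line.
  have [|Q dQ] := @exists_point _ _ (pi' :&: orth J <[u]>).
    have [u0|u0] := eqVneq u 0; last first.
      have du : \dim <[u]> = 1%N by rewrite dim_vline u0.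
      by have := dim_cap_orth J pi' du; rewrite (plane_dim pp') => /ltnW; case: (\dim _).
    rewrite (capv_idPl _) ?(plane_dim pp') //; apply/sub_orthP => w z.
    by rewrite u0 => /vlineP[a ->]; rewrite scaler0 bform0l.
  rewrite subv_cap => /andP[Qp' Qu]; exists (vpick Q); rewrite vpick_neq0 ?dQ // v0 mem0v.
  split=> //; first by apply: (subvP Qp'); apply: memv_pick.
  by have /orthP := subvP Qu _ (memv_pick Q); apply; apply: memv_line.
exists <[s]>%VS; first by apply/points_ofP; rewrite dim_vline s0 -memvE.
rewrite -memvE xE memv_add // memv_cap up /=; apply/orthP => _ /vlineP[a ->].
by rewrite bformZl (polar_form_sym hf us) mulr0.
Qed.

Lemma polarization_pi u v : u \in pi -> v \in pi -> polarization N u v = 0.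
Proof. by move=> up vp; rewrite /polarization !N_pi ?memvD // !subr0. Qed.

Lemma polarization_pi' u v : u \in pi' -> v \in pi' -> polarization N u v = 0.
Proof. by move=> up vp; rewrite /polarization !N_pi' ?memvD // !subr0. Qed.

(** Such a u lies in rho', since otherwise [rho' + <[u]>] would be a member of S of dimension 4.
    Thus J pairs two disjoint planes perfectly. *)
Lemma disjoint_orth rho rho' u : rho \in planes S -> rho' \in planes S ->
  (rho :&: rho' = 0)%VS -> u \in rho -> (forall v, v \in rho' -> bform J u v = 0) -> u = 0.
Proof.
move=> rp rp' dis ur h; have [rS _] := planesP _ _ rp; have [rS' dr'] := planesP _ _ rp'.
have ur' : u \in rho'.
  have uO : u \in orth J rho'.
    by apply/orthP => v vr'; apply: (polar_form_sym hf); apply: h.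
  apply: contraT => nur'; have := polar_rank hS (subspace_join hf rS' (subspace_sing hf rS ur) uO).
  by rewrite dim_add_vector ?dr'.
by apply/eqP; rewrite -memv0 -dis memv_cap ur.
Qed.

Lemma regulus_hyperbolic : hyperbolic_quadric (regulus_points (orth J) pi pi').
Proof.
exists W, N; split; last exact: regulus_pointsE.
- by rewrite dimv_disjoint_sum // (plane_dim pp) (plane_dim pp').
- move=> x /memv_addP[u up [v vp' ->]] h _.
  have u0 : u = 0.
    apply: (disjoint_orth pp pp' disj up) => z zp'.
    have zW : z \in W by apply: subvP zp'; apply: addvSr.
    have := h z zW; rewrite polarizationE bformDl -!polarizationE N_polar //.
    by rewrite polarization_pi' // addr0.
  have v0 : v = 0.
    have disj' : (pi' :&: pi = 0)%VS by rewrite capvC.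
    apply: (disjoint_orth pp' pp disj' vp') => z zp.
    have zW : z \in W by apply: subvP zp; apply: addvSl.
    have := h z zW; rewrite polarizationE bformDl -!polarizationE polarization_pi // add0r.
    by rewrite polarizationC N_polar // => zv; apply: (polar_form_sym hf).
  by rewrite u0 v0 addr0.
exists pi; split; [exact: addvSl | exact: plane_dim pp |].
by apply/forall_inP => u up; rewrite N_pi.
Qed.

Hypothesis N_planes : forall U, \dim U = 3%N -> (U <= W)%VS -> totally_singular N U -> U \in S.

Lemma regulus_embedded : embedded_hyperbolic_quadric S (regulus_points (orth J) pi pi').
Proof.
split; first exact: regulus_hyperbolic.
  apply/subsetP => P; rewrite in_set => /andP[/eqP dP /exists_inP[Q /points_ofP[dQ Qp'] PT]].
  have [TS _] := planesP _ _ (foot_plane_in hS pp pp' disj dQ Qp').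
  exact: (point_sub hS TS dP PT).
apply/subsetP => U; rewrite [U \in quadric_planes _]inE => /andP[/eqP dU /forallP UH].
have UP x : x \in U -> x \in W /\ qform N x = 0.
  move=> xU; have [->|x0] := eqVneq x 0; first by rewrite mem0v qform0.
  have := UH <[x]>%VS; rewrite dim_vline x0 -memvE xU /= regulus_pointsE inE dim_vline x0 /=.
  by rewrite -memvE totally_singular_line => /andP[-> /eqP].
apply/planesP; split=> //; apply: N_planes => //; first by apply/subvP => x /UP[].
by apply/forall_inP => x /UP[_ ->].
Qed.

End RegulusQuadric.

(** With N = M the quadric is the section of Q(6,q) by the hyperplane pi + pi', which every plane
    meets in at least a line. *)
Lemma parabolic_regulus_quadrics (F : finFieldType) (M : 'M[F]_7)
    (S := [set U | totally_singular M U]) :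
  nondegenerate_on M fullv -> planes S != set0 -> regulus_quadrics S (orth (M + M^T)).
Proof.
move=> nondeg S0 pi pi' pp pp' disj.
have hf := parabolic_polar_form nondeg; have hS := parabolic_polar_space nondeg S0.
have Q_pl rho u : rho \in planes S -> u \in rho -> qform M u = 0.
  by move=> /planesP[]; rewrite inE => /forall_inP h _ /h/eqP.
have polar u v : u \in pi -> v \in pi' -> polarization M u v = bform (M + M^T) u v.
  by rewrite polarizationE.
have Q_pi u := Q_pl pi u pp; have Q_pi' u := Q_pl pi' u pp'.
have regE := regulus_pointsE hf pp' Q_pi Q_pi' polar.
split.
  apply: (regulus_embedded hf hS pp pp' disj Q_pi Q_pi' polar) => U dU _ UM.
  by rewrite inE.
move=> U Up; exists (U :&: (pi + pi'))%VS; split; first exact: capvSl.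
  have := dimv_sum_cap U (pi + pi')%VS; rewrite (dimv_disjoint_sum disj).
  rewrite (plane_dim Up) (plane_dim pp) (plane_dim pp').
  have := dimvS (subvf (U + (pi + pi'))%VS); rewrite dim_rV.
  by move: (\dim _) (\dim _) => *; lia.
move=> P dP PU; rewrite regE in_set dP eqxx subv_cap PU /=.
case: (P <= pi + pi')%VS => //=; apply/forall_inP => u /(subvP PU) uU.
by rewrite (Q_pl U).
Qed.

Lemma sqr_surj_char2 (F : finFieldType) : 2%:R = 0 :> F -> forall a : F, exists b, b ^+ 2 = a.
Proof.
move=> F2; have sqr_inj : injective (fun b : F => b ^+ 2).
  move=> b c /eqP; rewrite -subr_eq0 (_ : b ^+ 2 - c ^+ 2 = (b - c) ^+ 2).
    by rewrite sqrf_eq0 subr_eq0 => /eqP.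
  have -> : (b - c) ^+ 2 = b ^+ 2 - c ^+ 2 + 2%:R * (c ^+ 2 - b * c) by ring.
  by rewrite F2 mul0r addr0.
by have [g _ gK] := injF_bij sqr_inj; move=> a; exists (g a); apply: gK.
Qed.

(* In characteristic 2 a quadratic form with zero polarization is semilinear
   with respect to the Frobenius automorphism, so its zeros form a subspace. *)
Lemma char2_zeros_subspace (F : finFieldType) (n : nat) (N : 'M[F]_n) (U : {vspace 'rV[F]_n}) :
  2%:R = 0 :> F -> (forall u v, u \in U -> v \in U -> polarization N u v = 0) ->
  exists K : {vspace 'rV[F]_n}, [/\ (K <= U)%VS, (\dim U <= (\dim K).+1)%N &
    forall x, x \in U -> (qform N x == 0) = (x \in K)].
Proof.
move=> F2 polar0; pose p K := (K <= U)%VS && totally_singular N K.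
have p0 : p 0%VS.
  by rewrite /p sub0v; apply/forall_inP => x; rewrite memv0 => /eqP->; rewrite qform0.
have addU x y : x \in U -> y \in U -> qform N (x + y) = qform N x + qform N y.
  by move=> xU yU; rewrite qformD polar0 ?addr0.
case: (@arg_maxnP _ 0%VS p (fun K => \dim K) p0) => K /andP[KU /forall_inP K0] Kmax.
have zeros x : x \in U -> (qform N x == 0) = (x \in K).
  move=> xU; apply/idP/idP => [/eqP x0|/K0 //]; apply: contraT => nxK.
  suff pKx : p (K + <[x]>)%VS by have := Kmax _ pKx; rewrite /= dim_add_vector // ltnn.
  rewrite /p subv_add KU -memvE xU; apply/forall_inP => _ /mem_line_add[y yK [a ->]].
  have /eqP y0 := K0 y yK.
  by rewrite addU ?memvZ ?(subvP KU y yK) // y0 qformZ x0 mulr0 addr0.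
exists K; split=> //; rewrite leqNgt; apply/negP => ltKU.
have /subvPn[a aU naK] : ~~ (U <= K)%VS by apply/negP => /dimvS; rewrite leqNgt ltnW.
have /subvPn[b bU nbK] : ~~ (U <= K + <[a]>)%VS.
  by apply/negP => /dimvS; rewrite dim_add_vector // leqNgt ltKU.
have Na : qform N a != 0 by rewrite zeros.
(* This c makes the value at [b + c *: a] equal to twice that at b, so zero; the vector then lies in
   K and b in [K + <[a]>]. *)
have [c cE] := sqr_surj_char2 F2 (qform N b / qform N a).
have : qform N (b + c *: a) == 0.
  rewrite addU ?memvZ // qformZ cE divfK //.
  by rewrite -[qform N b]mul1r -mulrDl -[1 + 1]/(2%:R) F2 mul0r.
rewrite zeros; last by rewrite memvD ?memvZ.
move=> bcaK; case/negP: nbK.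
by rewrite -[b](addrK (c *: a)) memv_add // memvN memvZ // memv_line.
Qed.

(** In characteristic 2 the form N x = B (p x) (r x), with p and r the projections onto pi and pi',
    has polarization B, so its totally singular subspaces are totally isotropic. On a plane of
    W(5,q) this polarization vanishes, and the zeros of N form a subspace of codimension at most
    1. *)
Lemma symplectic_regulus_quadrics (F : finFieldType) (J : 'M[F]_6)
    (S := [set U | totally_isotropic J U]) :
  (forall v, bform J v v = 0) -> J \in unitmx -> ~~ odd #|F| -> planes S != set0 ->
  regulus_quadrics S (orth J).
Proof.
move=> alt Ju evenF S0 pi pi' pp pp' disj; have F2 := even_field_two_eq0 evenF.
have hf := symplectic_polar_form alt Ju; have hS := symplectic_polar_space alt Ju S0.
have disj' : (pi' :&: pi = 0)%VS by rewrite capvC.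
pose p := daddv_pi pi pi'; pose r := daddv_pi pi' pi.
have Wfull : (pi + pi')%VS = fullv.
  apply/subv_dim_eq; first exact: subvf.
  by rewrite dimv_disjoint_sum // (plane_dim pp) (plane_dim pp') dim_rV.
have prE x : p x + r x = x by apply: daddv_pi_add; rewrite ?Wfull ?memvf.
have p_pi x : x \in pi -> p x = x by apply: daddv_pi_id.
have r_pi' x : x \in pi' -> r x = x by apply: daddv_pi_id.
have r_pi x : x \in pi -> r x = 0.
  by move=> xp; apply: (addrI (p x)); rewrite prE p_pi // addr0.
have p_pi' x : x \in pi' -> p x = 0.
  by move=> xp; apply: (addIr (r x)); rewrite prE r_pi' // add0r.
pose N := lin1_mx p *m J *m (lin1_mx r)^T.
have bN u v : bform N u v = bform J (p u) (r v).
  rewrite /bform /N -(mul_rV_lin1 p) -(mul_rV_lin1 r) trmx_mul !mulmxA.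
  by rewrite -!mulmxA.
have N_pi u : u \in pi -> qform N u = 0 by move=> up; rewrite /qform bN r_pi // bform0r.
have N_pi' u : u \in pi' -> qform N u = 0 by move=> up; rewrite /qform bN p_pi' // bform0l.
have polarN u v : polarization N u v = bform J u v.
  have B0 rho x y : rho \in planes S -> x \in rho -> y \in rho -> bform J x y = 0.
    by move=> /planesP[rS _]; apply: (subspace_isotropic hf rS).
  rewrite polarizationE bform_addmx bform_tr !bN -[in RHS](prE u) -[in RHS](prE v).
  have pp0 := B0 pi (p u) (p v) pp (memv_pi _ _ _) (memv_pi _ _ _).
  have rr0 := B0 pi' (r u) (r v) pp' (memv_pi _ _ _) (memv_pi _ _ _).
  rewrite bformDl !bformDr pp0 rr0.
  rewrite add0r addr0 (bform_anti alt (r u)); congr (_ + _).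
  by apply/eqP; rewrite -subr_eq0 opprK -mulr2n -mulr_natl F2 mul0r.
have polar u v : u \in pi -> v \in pi' -> polarization N u v = bform J u v by [].
have regE := regulus_pointsE hf pp' N_pi N_pi' polar.
split.
  apply: (regulus_embedded hf hS pp pp' disj N_pi N_pi' polar) => U dU _ /forall_inP U0.
  rewrite inE; apply/forall_inP => u uU; apply/forall_inP => v vU.
  rewrite -polarN /polarization (eqP (U0 _ uU)) (eqP (U0 _ vU)) (eqP (U0 _ (memvD uU vU))).
  by rewrite !subr0.
move=> U Up; have [US dU] := planesP _ _ Up.
have [|K [KU dK KE]] := @char2_zeros_subspace F 6 N U F2.
  by move=> u v uU vU; rewrite polarN (subspace_isotropic hf US).
exists K; split=> //; first by rewrite dU in dK.
move=> P dP PU; rewrite regE in_set dP eqxx Wfull subvf /=.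
rewrite -(dim1_vpick dP) totally_singular_line -memvE KE //.
exact: (subvP PU _ (memv_pick P)).
Qed.

Lemma W5_no_grid (F : finFieldType) (n : nat) (S : {set {vspace 'rV[F]_n}}) :
  is_W5 S -> odd #|F| -> no_grid S.
Proof.
by case=> n6; subst n; case=> J [alt Ju ->] oddF; apply: symplectic_no_grid.
Qed.

Lemma polar_space_W5_Q6 (F : finFieldType) (n : nat) (S : {set {vspace 'rV[F]_n}}) :
  is_W5 S \/ is_Q6 S -> planes S != set0 ->
  exists perp, polar_space S perp /\ (regulus_quadrics S perp \/ no_grid S).
Proof.
move=> hS S0; case: (hS) => [hW|[n7]].
  case: (hW) => n6; subst n; case=> J [alt Ju ES]; exists (orth J).
  have [oddF|evenF] := boolP (odd #|F|).
    split; last by right; apply: W5_no_grid.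
    by rewrite ES in S0 *; apply: symplectic_polar_space.
  by rewrite ES in S0 *; split;
    [apply: symplectic_polar_space | left; apply: symplectic_regulus_quadrics].
subst n; case=> M [nondeg ES]; exists (orth (M + M^T)); rewrite ES in S0 *.
by split; [apply: parabolic_polar_space | left; apply: parabolic_regulus_quadrics].
Qed.

(** * The numerical bound and the conclusion *)

Lemma cbrtX3 (R : realType) (a : R) : 0 <= a -> cbrt a ^+ 3 = a.
Proof.
by move=> a0; rewrite /cbrt -powR_mulrn ?powR_ge0 // -powRrM mulVf ?powRr1 ?pnatr_eq0.
Qed.

(** In terms of s = cbrt (4 a) one has a = s^3 / 4 and cbrt (2 a^2) = s^2 / 2, which leaves the
    polynomial inequality s^2 - 2 s / 3 + 1 / 3 <= s^3 / 4 + 2. *)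
Lemma cbrt_bound (R : realType) (a : R) : 0 <= a ->
  2 * (cbrt (2 * a ^+ 2) - cbrt (4 * a) / 3 + 1 / 6) <= a + 2.
Proof.
move=> a0; have s3 : cbrt (4 * a) ^+ 3 = 4 * a by rewrite cbrtX3 // mulr_ge0.
have t3 : cbrt (2 * a ^+ 2) ^+ 3 = 2 * a ^+ 2 by rewrite cbrtX3 // mulr_ge0 ?exprn_ge0.
have s0 : 0 <= cbrt (4 * a) := powR_ge0 _ _.
have t0 : 0 <= cbrt (2 * a ^+ 2) := powR_ge0 _ _.
move: (cbrt (4 * a)) (cbrt (2 * a ^+ 2)) s3 t3 s0 t0 => s t s3 t3 s0 t0.
have aE : a = s ^+ 3 / 4 by rewrite s3; field.
have -> : t = s ^+ 2 / 2.
  apply/eqP; rewrite -(@eqrXn2 _ 3) ?divr_ge0 ?exprn_ge0 //; apply/eqP.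
  by rewrite t3 aE; field.
(* The difference of the two sides is s (s / 2 - 1)^2 + (5 - s) / 3, which settles s <= 5; for s > 5
   already s^2 <= s^3 / 4. *)
rewrite aE; have [s5|s5] := lerP s 5; have := sqr_ge0 (s / 2 - 1); nra.
Qed.

Lemma degree_one_CL_weight (R : realType) (F : finFieldType) (n : nat)
    (S L : {set {vspace 'rV[F]_n}}) :
  degree_one_CL R S L -> exists w : {vspace 'rV[F]_n} -> R, CL_weight S w L.
Proof.
case=> LS [w wE].
(* The ranks [enum_rank_in] need a point of S as a witness; without points both sides are empty
   sums. *)
have [S0|/set0Pn[P0 P0S]] := eqVneq (points S) set0.
  exists (fun=> 0); split=> // pi pp.
  have := congr1 (fun A : 'cV[R]_#|planes S| => A (enum_rank_in pp pi) 0) wE.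
  rewrite !mxE enum_rankK_in // => ->.
  rewrite [LHS]big1 => [|Q _]; last by rewrite mul0r.
  have noP P : P \notin points S by rewrite S0 inE.
  by rewrite big1 // => i _; case/negP: (noP (enum_val i)); apply: enum_valP.
exists (fun P => w (enum_rank_in P0S P) 0); split=> // pi pp.
have := congr1 (fun A : 'cV[R]_#|planes S| => A (enum_rank_in pp pi) 0) wE.
rewrite !mxE enum_rankK_in // => ->; rewrite /weight big_enum_val.
by apply: eq_bigr => i _; rewrite !mxE enum_valK_in enum_rankK_in // mulrC.
Qed.

Theorem theorem5p9 (R : realType) (F : finFieldType) (n : nat)
    (S L : {set {vspace 'rV[F]_n}}) (x : R)
    (hS : is_W5 S \/ is_Q6 S)
    (hL : degree_one_CL R S L)
    (hx : x = CL_parameter R L)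
    (hx2 : 2 <= x)
    (hxq : x <= cbrt (2 * #|F|%:R ^+ 2) - cbrt (4 * #|F|%:R) / 3 + 1 / 6) :
  exists alpha : nat,
    [/\ exists (HH : {set {set {vspace 'rV[F]_n}}}) (V : {set {vspace 'rV[F]_n}}),
          [/\ #|HH| = alpha /\
              (forall H, H \in HH -> embedded_hyperbolic_quadric S H),
              forall H H', H \in HH -> H' \in HH -> H != H' ->
                [disjoint quadric_planes H & quadric_planes H'],
              [/\ V \subset points S,
                  #|V|%:R = x - 2 * alpha%:R,
                  forall P P', P \in V -> P' \in V -> P != P' ->
                    ~~ collinear S P P' /\
                    [disjoint point_pencil S P & point_pencil S P']
                & forall P H, P \in V -> H \in HH -> P \notin H]
            & L = (\bigcup_(H in HH) quadric_planes H)
                    :|: (\bigcup_(P in V) point_pencil S P)],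
        is_Q6 S \/ (is_W5 S /\ ~~ odd #|F|) -> (alpha <= Num.truncn (x / 2))%N
      & is_W5 S /\ odd #|F| -> alpha = 0%N].
Proof.
have q_gt1 := card_finNzRing_gt1 F.
have denom : (#|F|%:R + 1) * (#|F|%:R ^+ 2 + 1) != 0 :> R.
  by rewrite mulf_neq0 // gt_eqF // ltr_pwDr // exprn_ge0.
(* Without planes L would be empty and x = 0, against 2 <= x. *)
have S0 : planes S != set0.
  apply: contraTneq hx2 => P0; rewrite hx /CL_parameter.
  have [LS _] := hL; move: LS; rewrite P0 subset0 => /eqP ->.
  by rewrite cards0 mul0r -ltNge ltr0n.
have [perp [polarS geom]] := polar_space_W5_Q6 hS S0.
have [w wL] := degree_one_CL_weight hL; have [LS wLE] := wL.
have xE : total_weight S w = x.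
  rewrite hx /CL_parameter (CL_total_card polarS LS wLE S0).
  by rewrite mulrC mulKf.
have small : 2 * total_weight S w <= #|F|%:R + 2.
  by rewrite xE; apply: le_trans (cbrt_bound (ler0n _ _)); rewrite ler_pM2l.
have [HH [V [[HHq HHd [VS cV] [Vd VHd] LE] nogrid]]] :=
  exists_CL_decomposition polarS S0 geom wL small.
exists #|HH|; split.
- exists HH, V; split=> //; first by split=> // H /HHq[].
  split=> //; first by rewrite cV xE.
    move=> P P' PV PV' nPP'; split; last exact: Vd.
    apply/negP => PPS; have [_ dP] := pointsP _ _ (subsetP VS _ PV).
    have [_ dP'] := pointsP _ _ (subsetP VS _ PV').
    (* A line of S through P and P' lies on some plane, which would belong to both pencils. *)
    have /card_gt0P[pi] : (0 < #|[set pi in planes S | (P + P' <= pi)%VS]|)%N.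
      by rewrite (polar_line polarS PPS) ?dim_add_points // addn1.
    rewrite in_set subv_add => /and3P[pp Pp Pp'].
    have piP : pi \in point_pencil S P by rewrite in_set pp.
    by have := disjointFr (Vd P P' PV PV' nPP') piP; rewrite in_set pp Pp'.
  move=> P H PV HHH; apply/negP => PH; have [[_ _ HS] _ cov] := HHq H HHH.
  have [U UH PU] := cov P PH.
  have UP : U \in point_pencil S P by rewrite in_set (subsetP HS).
  by have := disjointFr (VHd P H PV HHH) UP; rewrite UH.
- move=> _; rewrite truncn_ge_nat; last by apply: divr_ge0; lra.
  (* The difference x - 2 alpha is the number of pencils, hence nonnegative. *)
  by rewrite ler_pdivlMr // mulrC -subr_ge0 -xE -cV.
by case=> hW oddF; rewrite nogrid ?cards0 //; apply: W5_no_grid.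
Qed.
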